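(* Let $0<T_{min}\le T_{max}<\infty$. Then the following statements are equivalent: (a) There exist matrices $P_i\in\mathbb{S}^{n+m}_{\succ0}$, $K_i\in\mathbb{R}^{m\times(n+m)}$, $i=1,\ldots,N$, a nonnegative matrix $\Pi=[\pi_{ij}]\in\mathbb{R}^{N\times N}$ verifying $\mathbf{1}_N^T\Pi=\mathbf{1}_N^T$ and a scalar $\varepsilon>0$ such that $$\bar J_i^Te^{\bar A^T\theta}\left(\sum_{j=1}^N\pi_{ji}P_j\right)e^{\bar A\theta}\bar J_i-P_i+\varepsilon I\preceq0$$ holds for all $i=1,\ldots,N$ and all $\theta\in[T_{min},T_{max}]$. (b) There exist differentiable matrix-valued functions $S_i:[0,T_{max}]\to\mathbb{S}^{n+m}$, matrices $P_i\in\mathbb{S}^{n+m}_{\succ0}$, $K_i\in\mathbb{R}^{m\times(n+m)}$, $i=1,\ldots,N$, a nonnegative matrix $\Pi\in\mathbb{R}^{N\times N}$ verifying $\mathbf{1}_N^T\Pi=\mathbf{1}_N^T$ and a scalar $\varepsilon>0$ such that $$-\dot{S}_i(\tau)+\bar A^TS_i(\tau)+S_i(\tau)\bar A\preceq0,$$ $$-P_i+\bar J_i^TS_i(\theta)\bar J_i+\varepsilon I\preceq0,$$ $$\sum_{j=1}^N\pi_{ji}P_j-S_i(0)\preceq0$$ hold for all $i=1,\ldots,N$, all $\tau\in[0,T_{max}]$ and all $\theta\in[T_{min},T_{max}]$. (c) There exist differentiable matrix-valued functions $\tilde S_i:[0,T_{max}]\to\mathbb{S}^{n+m}$, matrices $\tilde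 P_i\in\mathbb{S}^{n+m}_{\succ0}$, $U_i\in\mathbb{R}^{m\times(n+m)}$, $i=1,\ldots,N$, a nonnegative matrix $\Pi\in\mathbb{R}^{N\times N}$ verifying $\mathbf{1}_N^T\Pi=\mathbf{1}_N^T$ and a scalar $\varepsilon>0$ such that $$\dot{\tilde S}_i(\tau)+\tilde S_i(\tau)\bar A^T+\bar A\tilde S_i(\tau)\preceq0,$$ $$\begin{bmatrix}-\tilde P_i&(\bar J_i^0\tilde P_i+\bar J_i^1U_i)^T\\ \bar J_i^0\tilde P_i+\bar J_i^1U_i&-\tilde S_i(\theta)\end{bmatrix}\prec0,$$ $$-\operatorname{diag}_{j=1}^N\{\tilde P_j\}+V_i\tilde S_i(0)V_i^T\preceq0,$$ where $V_i=\operatorname{col}_{j=1}^N\{\pi_{ji}^{1/2}I_{n+m}\}$, hold for all $i=1,\ldots,N$, all $\tau\in[0,T_{max}]$ and all $\theta\in[T_{min},T_{max}]$. Moreover, when the conditions of statement (c) hold, then the inequality in (a) holds (for all $i$, all $\theta\in[T_{min},T_{max}]$, with the same $\Pi$ and some $\varepsilon>0$) with $K_i=U_i\tilde P_i^{-1}$ and $P_i=\tilde P_i^{-1}$, $i=1,\ldots,N$. As a result, the system $$\begin{array}{rcl}\dot{x}(t)&=&Ax(t)+Bu(t),\ t\in\mathbb{R}_{\ge0}\backslash\{t_k\}_{k=0}^\infty\\ u(t)&=&K_{\sigma(t_k^+)}^1x(t_k)+K_{\sigma(t_k^+)}^2u(t_k),\ t\in(t_k,t_{k+1}]\\ x(t_k^+)&=&J_{\sigma(t_k^+)}x(t_k),\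 k\in\mathbb{Z}_{\ge0}\end{array}$$ with the controller gains $[K_i^1\ \ K_i^2]=K_i=U_i\tilde P_i^{-1}$, $i=1,\ldots,N$, and the rule $\sigma(t_k^+)=\operatorname*{arg\,min}_{i\in\{1,\ldots,N\}}\{\chi(t_k)^TP_i\chi(t_k)\}$ with $P_i=\tilde P_i^{-1}$ and $\chi=\mathrm{col}(x,u)$, is asymptotically stable for any sequence $\{t_k\}_{k=0}^\infty$ satisfying the range dwell-time condition $t_{k+1}-t_k\in[T_{min},T_{max}]$ for all $k$.
   Context: $\mathbb{S}^{q}$ is the set of real symmetric $q\times q$ matrices, $\mathbb{S}^{q}_{\succ0}$ the positive definite ones; $X\preceq0$ (resp. $X\prec0$) means negative semidefinite (resp. definite). $\mathbf{1}_N$ is the $N$-vector of ones. A nonnegative matrix is a matrix with nonnegative entries. $\operatorname{diag}_{j=1}^N\{X_j\}$ is the block-diagonal matrix with blocks $X_1,\ldots,X_N$ and $\operatorname{col}_{j=1}^N\{X_j\}$ is the block column obtained by stacking $X_1,\ldots,X_N$. A dot on $S_i$ or $\tilde S_i$ denotes the derivative with respect to $\tau$. Data: integers $n,m,N\ge1$, real matrices $A\in\mathbb{R}^{n\times n}$, $B\in\mathbb{R}^{n\times m}$, $J_i\in\mathbb{R}^{n\times n}$, $i=1,\ldots,N$. For gains $K_i=[K_i^1\ \ K_i^2]$ with $K_i^1\in\mathbb{R}^{m\times n}$, $K_i^2\in\mathbb{R}^{m\times m}$, set $$\bar A=\begin{bmatrix}A&B\\ 0&0\end{bmatrix},\qquad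 \bar J_i=\begin{bmatrix}J_i&0\\ K_i^1&K_i^2\end{bmatrix}=\bar J_i^0+\bar J_i^1K_i,\qquad \bar J_i^0=\begin{bmatrix}J_i&0\\ 0&0\end{bmatrix},\quad \bar J_i^1=\begin{bmatrix}0\\ I_m\end{bmatrix}.$$ Trajectories are left-continuous: $x(t_k)=\lim_{s\uparrow t_k}x(s)$ and $x(t_k^+):=\lim_{s\downarrow t_k}x(s)$ (similarly for $u$, $\sigma$). The signal $\sigma(t)\in\{1,\ldots,N\}$ is piecewise constant and only changes value at the instants $t_k$. With $\chi=\mathrm{col}(x,u)$ the system reads $\dot\chi=\bar A\chi$ for $t\notin\{t_k\}$, $\chi(t_k^+)=\bar J_{\sigma(t_k^+)}\chi(t_k)$. In the rule, if the minimizer is not unique, any minimizer may be chosen. Asymptotic stability is understood in the usual sense for the zero solution of this (augmented) system: Lyapunov stability and convergence of $\chi(t)$ to $0$ as $t\to\infty$. *)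

(* Defs.v *)
From HB Require Import structures.
From mathcomp Require Import all_boot all_order all_algebra.
From mathcomp Require Import sesquilinear.
From mathcomp Require Import all_classical all_reals all_analysis.

Set Implicit Arguments.
Unset Strict Implicit.
Unset Printing Implicit Defensive.

Import Order.TTheory GRing.Theory Num.Theory.
Import numFieldNormedType.Exports.

Local Open Scope classical_set_scope.
Local Open Scope ring_scope.

Section Matrices.
Variable R : realType.

Definition qform (q : nat) (X : 'M[R]_q) (v : 'cV[R]_q) : R :=
  (v^T *m X *m v) 0 0.

(* Definiteness is a property of symmetric matrices only. *)
Definition posdef (q : nat) (X : 'M[R]_q) : Prop :=
  X \is symmetricmx /\ forall v : 'cV[R]_q, v != 0 -> 0 < qform X v.

Definition negdef (q : nat) (X : 'M[R]_q) : Prop :=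
  X \is symmetricmx /\ forall v : 'cV[R]_q, v != 0 -> qform X v < 0.

Definition negsemidef (q : nat) (X : 'M[R]_q) : Prop :=
  X \is symmetricmx /\ forall v : 'cV[R]_q, qform X v <= 0.

Definition expmx (q : nat) (X : 'M[R]_q) : 'M[R]_q :=
  limn (series (fun k : nat => (k`!%:R)^-1 *: X ^+ k)).

(* [df] is the derivative of [f] at [x] relative to the domain [D]: a one-sided
   derivative when [x] is an end point of the interval [D]. *)
Definition is_derive_within (V : normedModType R) (D : set R) (f : R -> V)
    (x : R) (df : V) : Prop :=
  (y - x)^-1 *: (f y - f x) @[y --> within D x^'] --> df.

Definition nonneg_colstochastic (N : nat) (Pi : 'M[R]_N) : Prop :=
  (forall i j, 0 <= Pi i j) /\
  (const_mx 1 : 'rV[R]_N) *m Pi = (const_mx 1 : 'rV[R]_N).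

End Matrices.

Section System.
Variables (R : realType) (n m N : nat).
Variables (A : 'M[R]_n) (B : 'M[R]_(n, m)) (J : 'I_N -> 'M[R]_n).

Definition Abar : 'M[R]_(n + m) := block_mx A B 0 0.

Definition Jbar (K : 'I_N -> 'M[R]_(m, n + m)) (i : 'I_N) : 'M[R]_(n + m) :=
  block_mx (J i) 0 (lsubmx (K i)) (rsubmx (K i)).

Definition Jbar0 (i : 'I_N) : 'M[R]_(n + m) := block_mx (J i) 0 0 0.

Definition Jbar1 : 'M[R]_(n + m, m) := col_mx 0 1%:M.

Lemma JbarE (K : 'I_N -> 'M[R]_(m, n + m)) (i : 'I_N) :
  Jbar K i = Jbar0 i + Jbar1 *m K i.
Proof.
rewrite /Jbar /Jbar0 /Jbar1 -[in RHS](hsubmxK (K i)) mul_col_row.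
by rewrite !mul0mx !mul1mx add_block_mx !addr0 !add0r.
Qed.

Definition Vcol (Pi : 'M[R]_N) (i : 'I_N) :
    'M[R]_(\sum_(j < N) (n + m), n + m) :=
  \mxcol_(j < N) ((Num.sqrt (Pi j i))%:M : 'M[R]_(n + m)).

Variables (Tmin Tmax : R).

Definition cond_a (P : 'I_N -> 'M[R]_(n + m)) (K : 'I_N -> 'M[R]_(m, n + m))
    (Pi : 'M[R]_N) (eps : R) : Prop :=
  [/\ forall i, posdef (P i),
      nonneg_colstochastic Pi,
      0 < eps &
      forall i (theta : R), theta \in `[Tmin, Tmax] ->
        negsemidef ((Jbar K i)^T *m expmx (theta *: Abar^T)
                      *m (\sum_(j < N) Pi j i *: P j)
                      *m expmx (theta *: Abar) *m Jbar K i
                    - P i + eps%:M)].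

Definition cond_b (S dS : 'I_N -> R -> 'M[R]_(n + m))
    (P : 'I_N -> 'M[R]_(n + m)) (K : 'I_N -> 'M[R]_(m, n + m))
    (Pi : 'M[R]_N) (eps : R) : Prop :=
  [/\ forall i, posdef (P i),
      nonneg_colstochastic Pi,
      0 < eps,
      forall i (tau : R), tau \in `[0, Tmax] ->
        S i tau \is symmetricmx /\
        is_derive_within `[0, Tmax] (S i) tau (dS i tau) &
      forall i,
        [/\ forall tau : R, tau \in `[0, Tmax] ->
              negsemidef (- dS i tau + Abar^T *m S i tau + S i tau *m Abar),
            forall theta : R, theta \in `[Tmin, Tmax] ->
              negsemidef (- P i + (Jbar K i)^T *m S i theta *m Jbar K i
                          + eps%:M) &
            negsemidef (\sum_(j < N) Pi j i *: P j - S i 0)]].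

(* [eps] does not occur in the inequalities; it is kept for uniformity with the
   two other conditions. *)
Definition cond_c (S dS : 'I_N -> R -> 'M[R]_(n + m))
    (P : 'I_N -> 'M[R]_(n + m)) (U : 'I_N -> 'M[R]_(m, n + m))
    (Pi : 'M[R]_N) (eps : R) : Prop :=
  [/\ forall i, posdef (P i),
      nonneg_colstochastic Pi,
      0 < eps,
      forall i (tau : R), tau \in `[0, Tmax] ->
        S i tau \is symmetricmx /\
        is_derive_within `[0, Tmax] (S i) tau (dS i tau) &
      forall i,
        [/\ forall tau : R, tau \in `[0, Tmax] ->
              negsemidef (dS i tau + S i tau *m Abar^T + Abar *m S i tau),
            forall theta : R, theta \in `[Tmin, Tmax] ->
              negdef (block_mx (- P i) (Jbar0 i *m P i + Jbar1 *m U i)^T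
                               (Jbar0 i *m P i + Jbar1 *m U i) (- S i theta)) &
            negsemidef (- (\mxdiag_(j < N) P j)
                        + Vcol Pi i *m S i 0 *m (Vcol Pi i)^T)]].

Definition range_dwell_time (t : nat -> R) : Prop :=
  0 <= t 0%N /\ forall k, t k.+1 - t k \in `[Tmin, Tmax].

End System.

Section ClosedLoop.
Variables (R : realType) (n m N : nat).
Variables (A : 'M[R]_n) (B : 'M[R]_(n, m)) (J : 'I_N -> 'M[R]_n).
Variables (K : 'I_N -> 'M[R]_(m, n + m)) (P : 'I_N -> 'M[R]_(n + m)).
Variable t : nat -> R.

(* Trajectories live on [0, +oo[ (values at negative times are irrelevant).
   [sp k] is sigma(t_k^+); [traj_sigma] says that the left-continuous signal
   [sigma] changes value only at the instants [t k] and has right limit [sp k]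
   there.  Before the first instant [t 0], the augmented flow
   chi' = Abar chi keeps [u] constant ([traj_u_init]). *)
Record closed_loop_trajectory (x : R -> 'cV[R]_n) (u : R -> 'cV[R]_m)
    (sigma : R -> 'I_N) (sp : nat -> 'I_N) : Prop := ClosedLoopTrajectory {
  traj_sigma_init : forall s : R, 0 <= s <= t 0%N -> sigma s = sigma 0;
  traj_sigma : forall k (s : R), t k < s <= t k.+1 -> sigma s = sp k;
  traj_rule : forall k j,
    qform (P (sp k)) (col_mx (x (t k)) (u (t k)))
      <= qform (P j) (col_mx (x (t k)) (u (t k)));
  traj_left_continuous : forall s : R, 0 < s -> x r @[r --> s^'-] --> x s;
  traj_flow : forall s : R, 0 <= s -> (forall k, s != t k) ->
    is_derive_within [set r | 0 <= r] x s (A *m x s + B *m u s);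
  traj_jump : forall k, x r @[r --> (t k)^'+] --> J (sp k) *m x (t k);
  traj_u_init : forall s : R, 0 <= s <= t 0%N -> u s = u 0;
  traj_u : forall k (s : R), t k < s <= t k.+1 ->
    u s = lsubmx (K (sp k)) *m x (t k) + rsubmx (K (sp k)) *m u (t k)
}.

Definition closed_loop : set (R -> 'cV[R]_(n + m)) :=
  [set chi | exists x u sigma sp,
     closed_loop_trajectory x u sigma sp /\
     chi = fun s => col_mx (x s) (u s)].

End ClosedLoop.

(* Asymptotic stability of the zero solution of a system with state in R^q
   given by its set of trajectories. *)
Definition asymptotically_stable (R : realType) (q : nat)
    (traj : set (R -> 'cV[R]_q)) : Prop :=
  (forall e : R, 0 < e -> exists2 d : R, 0 < d &
     forall chi, traj chi -> `|chi 0| < d ->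
       forall s : R, 0 <= s -> `|chi s| < e) /\
  (forall chi, traj chi -> chi s @[s --> +oo] --> (0 : 'cV[R]_q)).

(* Main.v *)
(* Write E(s) = exp(s Abar) and M_i = sum_j pi_ji P_j.  (a) => (b) takes
   S_i(s) = E(s)^T M_i E(s), for which the differential inequality is an
   equality; conversely that inequality makes E(-s)^T S_i(s) E(-s) nondecreasing,
   whence E(s)^T M_i E(s) <= S_i(s).  (a) => (c) takes the inverse of that S_i.
   (c) => (a) needs no inverse of S~_i: the block inequality is tested on the
   pairs (P~_i^-1 z, E(s)^T M_i E(s) Jbar_i z) and the last one on the columns
   diag(P_j) V_i a; this gives the inequality of (a) strictly at each theta, and
   compactness of [Tmin, Tmax] times the unit sphere yields a uniform eps.

   For the stability, chi(t_{k+1}) = E(t_{k+1} - t_k) Jbar_i chi(t_k) with i the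
   mode selected at t_k; the minimum over j of chi^T P_j chi is at most the
   convex combination chi^T M_i chi, so by (a) it decreases geometrically along
   the t_k, and E is bounded between two of them. *)

Require Import Defs.
From HB Require Import structures.
From mathcomp Require Import all_boot all_order all_algebra.
From mathcomp Require Import sesquilinear ring lra.
From mathcomp Require Import all_classical all_reals all_analysis.

Set Implicit Arguments.
Unset Strict Implicit.
Unset Printing Implicit Defensive.

Import Order.TTheory GRing.Theory Num.Theory.
Import numFieldNormedType.Exports.

Local Open Scope classical_set_scope.
Local Open Scope ring_scope.

(** * Derivatives of matrix-valued functions *)

Lemma ler_mx_entry (R : realType) (m n : nat) (M : 'M[R]_(m, n)) i j :
  `|M i j| <= `|M|.
Proof.
rewrite [leRHS]/Num.norm /= mx_normrE; apply/bigmax_geP; right => /=.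
by exists (i, j).
Qed.

Lemma ler_mx_norm (R : realType) (m n : nat) (M : 'M[R]_(m, n)) (c : R) :
  0 <= c -> (forall i j, `|M i j| <= c) -> `|M| <= c.
Proof.
move=> c0 Mc; rewrite [leLHS]/Num.norm /= mx_normrE.
by apply/bigmax_leP; split=> // -[i j] _; exact: Mc.
Qed.

Lemma norm_trmx (R : realType) (m p : nat) (M : 'M[R]_(m, p)) : `|M^T| = `|M|.
Proof.
apply/eqP; rewrite eq_le; apply/andP; split; apply: ler_mx_norm => // i j.
  by rewrite mxE; exact: ler_mx_entry.
by have := ler_mx_entry M^T j i; rewrite mxE.
Qed.

Lemma ler_norm_mulmx (R : realType) (m p r : nat) (M : 'M[R]_(m, p))
    (X : 'M[R]_(p, r)) :
  `|M *m X| <= p%:R * `|M| * `|X|.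
Proof.
apply: ler_mx_norm => [|i j]; first by rewrite !mulr_ge0.
rewrite mxE; apply: le_trans (ler_norm_sum _ _ _) _.
rewrite -mulrA mulr_natl -[X in _ <= _ *+ X]card_ord -sumr_const.
apply: ler_sum => k _; rewrite normrM.
by apply: ler_pM => //; exact: ler_mx_entry.
Qed.

(** The norm is the largest absolute value of an entry, and there are finitely many entries, so a
    single event of the filter controls them all. *)
Lemma cvg_mxP (R : realType) (m n : nat) (T : Type) (F : set_system T)
    {FF : Filter F} (f : T -> 'M[R]_(m, n)) (M : 'M[R]_(m, n)) :
  f t @[t --> F] --> M <-> forall i j, f t i j @[t --> F] --> M i j.
Proof.
split=> [fM i j|fM].
  exact: (cvg_comp f (fun N : 'M[R]_(m, n) => N i j) fM
    (@coord_continuous _ _ _ i j M)).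
apply/cvgrPdist_le => e e0.
have : \forall t \near F, forall i j, `|M i j - f t i j| <= e.
  apply: filter_forall => i; apply: filter_forall => j.
  by have /cvgrPdist_le/(_ e e0) := fM i j.
apply: filterS => t Mf; apply: ler_mx_norm (ltW e0) _ => i j.
by rewrite !mxE.
Qed.

Lemma cvg_mulmx (R : realType) (m n p : nat) (T : Type) (F : set_system T)
    {FF : Filter F} (f : T -> 'M[R]_(m, n)) (g : T -> 'M[R]_(n, p))
    (M : 'M[R]_(m, n)) (N : 'M[R]_(n, p)) :
  f t @[t --> F] --> M -> g t @[t --> F] --> N ->
  (f t *m g t) @[t --> F] --> (M *m N).
Proof.
move=> /cvg_mxP fM /cvg_mxP gN; apply/cvg_mxP => i j.
rewrite mxE; under eq_fun do rewrite mxE.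
by apply: cvg_big => [|k _]; [exact: add_continuous|exact: cvgM].
Qed.

Lemma cvg_trmx (R : realType) (m n : nat) (T : Type) (F : set_system T)
    {FF : Filter F} (f : T -> 'M[R]_(m, n)) (M : 'M[R]_(m, n)) :
  f t @[t --> F] --> M -> (f t)^T @[t --> F] --> M^T.
Proof.
move=> /cvg_mxP fM; apply/cvg_mxP => i j; rewrite mxE.
under eq_fun do rewrite mxE.
exact: fM.
Qed.

Lemma cvg_col_mx (R : realType) (m p r : nat) (T : Type) (G : set_system T)
    {FG : Filter G} (f : T -> 'M[R]_(m, r)) (g : T -> 'M[R]_(p, r))
    (M : 'M[R]_(m, r)) (X : 'M[R]_(p, r)) :
  f t @[t --> G] --> M -> g t @[t --> G] --> X ->
  col_mx (f t) (g t) @[t --> G] --> col_mx M X.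
Proof.
move=> /cvg_mxP fM /cvg_mxP gX; apply/cvg_mxP => i j.
case: (split_ordP i) => k ->.
  by rewrite col_mxEu; under eq_fun do rewrite col_mxEu; exact: fM.
by rewrite col_mxEd; under eq_fun do rewrite col_mxEd; exact: gX.
Qed.

(** * Calculus of derivatives relative to a domain *)

Section DeriveWithin.
Variable R : realType.
Implicit Types (D : set R) (x : R).

Lemma is_derive_withinW (V : normedModType R) D D' (f : R -> V) x df :
  D' `<=` D -> is_derive_within D f x df -> is_derive_within D' f x df.
Proof.
move=> D'D; apply: cvg_trans; apply: cvg_app => A [B Bx BA].
by exists B => // y By yx D'y; apply: BA => //; exact: D'D.
Qed.

Let near_within_neq D x : \forall y \near within D x^', y - x != 0.
Proof. by exists 1 => //= y _ yx _; rewrite subr_eq0. Qed.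

Let cvg_within_subr D x : (y - x) @[y --> within D x^'] --> (0 : R).
Proof.
rewrite -(subrr x); apply: cvgB; last exact: cvg_cst.
move=> A [e e0 Ae]; exists e => //= y xy _ _; exact: Ae.
Qed.

Lemma is_derive_within_cvg (V : normedModType R) D (f : R -> V) x df :
  is_derive_within D f x df -> f y @[y --> within D x^'] --> f x.
Proof.
move=> fx; have -> : f x = 0 *: df + f x by rewrite scale0r add0r.
have : (y - x) *: ((y - x)^-1 *: (f y - f x)) + f x @[y --> within D x^']
    --> 0 *: df + f x.
  by apply: cvgD; [apply: cvgZ => //; exact: cvg_within_subr|exact: cvg_cst].
apply: cvg_trans; apply: near_eq_cvg.
have := near_within_neq D x; apply: filterS => y yx.
by rewrite scalerA divff// scale1r subrK.
Qed.

Lemma is_derive_within_cst (V : normedModType R) D (a : V) x :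
  is_derive_within D (fun=> a) x 0.
Proof.
rewrite /is_derive_within; under eq_fun do rewrite subrr scaler0.
exact: cvg_cst.
Qed.

Lemma is_derive_withinN (V : normedModType R) D (f : R -> V) x df :
  is_derive_within D f x df -> is_derive_within D (fun y => - f y) x (- df).
Proof.
move=> /cvgN; apply: cvg_trans; apply: near_eq_cvg; near=> y.
by rewrite fctE -scalerN opprB opprK [- f y + _]addrC.
Unshelve. all: by end_near. Qed.

Lemma is_derive_within_shift (V : normedModType R) D (f : R -> V) a x df :
  is_derive_within setT f (x - a) df ->
  is_derive_within D (fun y => f (y - a)) x df.
Proof.
have subE y z : z - a - (y - a) = z - y :> R by ring.
have xa : (y - a) @[y --> within D x^'] --> within setT (x - a)^'.
  move=> P [d /= d0 dP]; exists d => // y /= xy yx _; apply: dP => //=.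
    by rewrite subE.
  by rewrite (inj_eq (addIr _)).
move=> /(cvg_comp _ _ xa); rewrite /comp /is_derive_within.
by under eq_fun do rewrite subE.
Qed.

Lemma is_derive_within_col_mx D m p r (f : R -> 'M[R]_(m, r))
    (g : R -> 'M[R]_(p, r)) x (df : 'M[R]_(m, r)) (dg : 'M[R]_(p, r)) :
  is_derive_within D f x df -> is_derive_within D g x dg ->
  is_derive_within D (fun y => col_mx (f y) (g y)) x (col_mx df dg).
Proof.
move=> fx gx; have : col_mx ((y - x)^-1 *: (f y - f x))
    ((y - x)^-1 *: (g y - g x)) @[y --> within D x^'] --> col_mx df dg.
  exact: cvg_col_mx.
apply: cvg_trans; apply: near_eq_cvg; near=> y.
by rewrite opp_col_mx add_col_mx scale_col_mx.
Unshelve. all: by end_near. Qed.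

Lemma is_derive_within_mulmx D (m n p : nat) (f : R -> 'M[R]_(m, n))
    (g : R -> 'M[R]_(n, p)) x df dg :
  is_derive_within D f x df -> is_derive_within D g x dg ->
  is_derive_within D (fun y => f y *m g y) x (df *m g x + f x *m dg).
Proof.
move=> dfx dgx; have gx := is_derive_within_cvg dgx.
(* The increment of the product is split as (f y - f x) g y + f x (g y - g x); the first term needs
   the continuity of [g] at [x]. *)
have : ((y - x)^-1 *: (f y - f x)) *m g y
    + f x *m ((y - x)^-1 *: (g y - g x)) @[y --> within D x^']
    --> df *m g x + f x *m dg.
  by apply: cvgD; apply: cvg_mulmx => //; exact: cvg_cst.
apply: cvg_trans; apply: near_eq_cvg; near=> y.
by rewrite -scalemxAl -scalemxAr -scalerDr mulmxBl mulmxBr addrA subrK.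
Unshelve. all: by end_near. Qed.

Lemma is_derive_within_trmx D (m n : nat) (f : R -> 'M[R]_(m, n)) x df :
  is_derive_within D f x df -> is_derive_within D (fun y => (f y)^T) x df^T.
Proof.
move=> /cvg_trmx; apply: cvg_trans; apply: near_eq_cvg; near=> y.
by rewrite linearZ linearB.
Unshelve. all: by end_near. Qed.

Lemma is_derive_within_entry D (m n : nat) (f : R -> 'M[R]_(m, n)) x df i j :
  is_derive_within D f x df -> is_derive_within D (fun y => f y i j) x (df i j).
Proof.
move=> /cvg_mxP/(_ i j); apply: cvg_trans; apply: near_eq_cvg; near=> y.
by rewrite !mxE.
Unshelve. all: by end_near. Qed.

(** Bridge to the scalar derivative of the library: as [D] is a neighbourhood of [x], small nonzero
    increments from [x] stay in [D]. *)
Lemma is_derive_withinE D (f : R -> R) x df :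
  nbhs x D -> is_derive_within D f x df -> is_derive x 1 f df.
Proof.
move=> [e /= e0 eD] fx.
have shx : h + x @[h --> (0 : R)^'] --> within D x^'.
  move=> A [d /= d0 dA]; exists (Num.min d e) => [|h /=].
    by rewrite /= lt_min d0.
  rewrite sub0r normrN lt_min => /andP[hd he] h0; apply: dA => /=.
  - by rewrite opprD addrCA subrr addr0 normrN.
  - by rewrite -[X in _ != X]add0r (inj_eq (addIr x)).
  - by apply: eD => /=; rewrite opprD addrCA subrr addr0 normrN.
have {fx shx} := cvg_comp _ _ shx fx.
rewrite /comp; under eq_fun do rewrite addrK.
move=> fx; have {}fx : h^-1 *: ((f \o shift x) (h *: 1) - f x) @[h --> 0^'] --> df.
  by move: fx; under [X in _ -> X @ _ --> _]eq_fun do rewrite /= [_ *: 1]mulr1.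
by apply: DeriveDef; [apply/cvg_ex; exists df|exact: cvg_lim fx].
Qed.

Lemma is_derive_within_mx D (m n : nat) (f : R -> 'M[R]_(m, n)) x
    (df : 'M[R]_(m, n)) :
  (forall i j, is_derive x 1 (fun y => f y i j) (df i j)) ->
  is_derive_within D f x df.
Proof.
move=> fx; apply/cvg_mxP => i j.
have [fd fdE] := fx i j.
have {fdE} : h^-1 *: (f (h *: 1 + x) i j - f x i j) @[h --> (0 : R)^'] --> df i j.
  by rewrite -fdE; exact: fd.
have yx : (y - x) @[y --> within D x^'] --> (0 : R)^'.
  move=> A [d /= d0 dA]; exists d => // y /= xy yx _; apply: dA => /=.
    by rewrite sub0r opprB.
  by rewrite subr_eq0.
move=> /(cvg_comp _ _ yx); rewrite /comp.
under [X in X @ _ --> _ -> _]eq_fun do rewrite [_ *: 1]mulr1 subrK.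
by apply: cvg_trans; apply: near_eq_cvg; near=> y; rewrite !mxE.
Unshelve. all: by end_near. Qed.

(** Only one-sided limits at the end points enter, so that functions with a jump there are covered.
    The function is monotone on the open interval, and both limits are compared with its value at
    the midpoint. *)
Lemma is_derive_within_le (f df : R -> R) (a b la lb : R) : a < b ->
  (forall x, a < x < b -> is_derive_within `]a, b[ f x (df x)) ->
  (forall x, a < x < b -> 0 <= df x) ->
  f y @[y --> a^'+] --> la -> f y @[y --> b^'-] --> lb -> la <= lb.
Proof.
move=> ab fd df0 fa fb.
have fd' x : x \in `]a, b[ -> is_derive x 1 f (df x).
  move=> xab; apply: is_derive_withinE (fd _ _) => //.
  exact: near_in_itvoo.
have fle : {in `]a, b[ &, {homo f : x y / x <= y}}.
  apply: ger0_derive1_le_oo => x xab.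
  - by have [] := fd' _ xab.
  - by have [? fx] := fd' _ xab; rewrite derive1E fx; exact: df0.
  - rewrite inE in xab; have [? _] := fd' _ xab.
    exact/differentiable_continuous/derivable1_diffP.
pose c := (a + b) / 2.
have cab : c \in `]a, b[ by exact: mid_in_itvoo.
have /andP[ac cb] : a < c < b by exact: cab.
apply: (@le_trans _ _ (f c)).
  apply: (cvgr_to_le fa); near=> y.
  have /andP[ay yc] : a < y < c.
    apply/andP; split; near: y; first exact: nbhs_right_gt.
    exact: nbhs_right_lt.
  apply: fle => //; last exact: ltW.
  by rewrite in_itv /= ay (lt_trans yc).
apply: (cvgr_to_ge fb); near=> y.
have /andP[ay yc] : c < y < b.
  apply/andP; split; near: y; last exact: nbhs_left_lt.
  exact: nbhs_left_gt.
apply: fle => //; last exact: ltW.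
by rewrite in_itv /= yc (lt_trans ac).
Unshelve. all: by end_near. Qed.
(** Monotonicity applied to each entry of [f] and of [- f] gives the two inequalities. *)
Lemma is_derive_within0_eq m p (f : R -> 'M[R]_(m, p)) (a b : R)
    (la lb : 'M[R]_(m, p)) : a < b ->
  (forall x, a < x < b -> is_derive_within `]a, b[ f x 0) ->
  f y @[y --> a^'+] --> la -> f y @[y --> b^'-] --> lb -> la = lb.
Proof.
have le (g : R -> 'M[R]_(m, p)) (ga gb : 'M[R]_(m, p)) i j : a < b ->
    (forall x, a < x < b -> is_derive_within `]a, b[ g x 0) ->
    g y @[y --> a^'+] --> ga -> g y @[y --> b^'-] --> gb -> ga i j <= gb i j.
  move=> ab gd /cvg_mxP/(_ i j) gai /cvg_mxP/(_ i j) gbi.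
  apply: (is_derive_within_le (df := fun=> 0) ab _ _ gai gbi) => // x xab.
  have := @is_derive_within_entry _ _ _ _ _ _ i j (gd x xab).
  by rewrite mxE.
move=> ab fd fa fb; apply/matrixP => i j; apply/eqP; rewrite eq_le.
rewrite (le f la lb i j)//=.
have := le (fun y => - f y) (- la) (- lb) i j ab _ (cvgN fa) (cvgN fb).
rewrite !mxE lerN2; apply => x xab.
by rewrite -oppr0; exact: is_derive_withinN (fd x xab).
Qed.

Lemma is_derive_within_le_cc (f df : R -> R) (a b : R) : a <= b ->
  (forall x, a <= x <= b -> is_derive_within `[a, b] f x (df x)) ->
  (forall x, a <= x <= b -> 0 <= df x) -> f a <= f b.
Proof.
rewrite le_eqVlt => /predU1P[->//|ab] fd df0.
have oo x : a < x < b -> a <= x <= b by move=> /andP[/ltW-> /ltW->].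
apply: (@is_derive_within_le f df a b) => // [x /oo xab|x /oo||].
- by apply: is_derive_withinW (fd _ xab); exact: subset_itv_oo_cc.
- exact: df0.
- have := is_derive_within_cvg (fd a _); rewrite lexx ltW// => /(_ isT).
  apply: cvg_trans; apply: cvg_app => A [e /= e0 eA].
  (* The radius [b - a] keeps the points to the right of [a] inside [a, b]. *)
  exists (Num.min e (b - a)) => /=; first by rewrite lt_min e0 subr_gt0.
  move=> y /=; rewrite lt_min => /andP[ye yb] ay; apply: eA => //.
    by rewrite gt_eqF.
  rewrite /= in_itv /= ltW//=; move: yb; rewrite distrC ger0_norm ?subr_ge0 ?(ltW ay)//.
  by rewrite ltrD2r => /ltW.
- have := is_derive_within_cvg (fd b _); rewrite lexx ltW// => /(_ isT).
  apply: cvg_trans; apply: cvg_app => A [e /= e0 eA].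
  exists (Num.min e (b - a)) => /=; first by rewrite lt_min e0 subr_gt0.
  move=> y /=; rewrite lt_min => /andP[ye yb] ay; apply: eA => //.
    by rewrite lt_eqF.
  rewrite /= in_itv /= ltW ?ltW//=; move: yb; rewrite ger0_norm ?subr_ge0 ?(ltW ay)//.
  by rewrite ltrD2l ltrN2.
Qed.

End DeriveWithin.

(** * Matrix exponential *)

Section Expmx.
Variables (R : realType) (q : nat).
Implicit Types (X : 'M[R]_q) (s : R).

Let sumr_const_ordE (a : R) : \sum_(l < q) a = q%:R * a.
Proof. by rewrite sumr_const card_ord mulr_natl. Qed.

(** For the largest-entry norm each matrix product costs a factor [q]. *)
Lemma ler_expr_entry X k i j : `|(X ^+ k) i j| <= (q%:R * `|X|) ^+ k.
Proof.
elim: k i j => [|k IH] i j.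
  by rewrite !expr0 mxE; case: (i == j); rewrite ?normr1 ?normr0.
rewrite exprS mxE; apply: le_trans (ler_norm_sum _ _ _) _.
rewrite exprS -mulrA -sumr_const_ordE.
apply: ler_sum => l _; rewrite normrM.
by apply: ler_pM => //; exact: ler_mx_entry.
Qed.

Let expr_scalemx s X k : (s *: X) ^+ k = s ^+ k *: X ^+ k.
Proof.
elim: k => [|k IH]; first by rewrite !expr0 scale1r.
by rewrite !exprSr IH -!mulmxE -scalemxAl -scalemxAr scalerA.
Qed.

(** Taylor coefficients at 0 of the (i, j) entry of C exp(s X) as a function of s. The left factor
    [C] makes the family stable under differentiation, which replaces [C] by [C *m X]. *)
Let coef (C X : 'M[R]_q) (i j : 'I_q) (k : nat) : R := (k`!%:R)^-1 * (C *m X ^+ k) i j.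

Let pseries_diffs_coef C X i j :
  pseries_diffs (coef C X i j) = coef (C *m X) X i j.
Proof.
apply/funext => k; rewrite /pseries_diffs /coef exprS mulmxA.
by rewrite factS natrM invfM mulrA mulVKf ?pnatr_eq0.
Qed.

Let is_cvg_pseries_coef C X i j s : cvgn (pseries (coef C X i j) s).
Proof.
apply: normed_cvg.
pose M : R := q%:R * `|C|; pose c : R := q%:R * `|X| * `|s|.
have M0 : 0 <= M by rewrite mulr_ge0.
have c0 : 0 <= c by rewrite !mulr_ge0.
(* The majorant is q |C| times the scalar exponential series at q |X| |s|. *)
apply: (@series_le_cvg _ _ (M *: exp_coeff c)) => [k|k|k|].
- exact: normr_ge0.
- by apply: mulr_ge0 => //; exact: exp_coeff_ge0.
- rewrite /= (_ : (M *: exp_coeff c) k = M * c ^+ k * (k`!%:R)^-1); last first.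
    by rewrite -mulrA.
  rewrite /coef !normrM normfV normr_nat -mulrA mulrC.
  rewrite ler_wpM2r ?invr_ge0 ?ler0n// exprMn normrX mulrA.
  rewrite ler_wpM2r ?exprn_ge0//.
  rewrite mxE; apply: le_trans (ler_norm_sum _ _ _) _.
  rewrite /M -mulrA -sumr_const_ordE; apply: ler_sum => l _; rewrite normrM.
  by apply: ler_pM => //; [exact: ler_mx_entry|exact: ler_expr_entry].
- by apply: is_cvg_seriesZ; exact: is_cvg_series_exp_coeff.
Qed.

(** [expmx] is a [limn], which carries information only once the series is known to converge; this
    is checked entrywise, with the entry series taken at 1. *)
Lemma cvg_expmx X :
  series (fun k => (k`!%:R)^-1 *: X ^+ k) n @[n --> \oo] --> expmx X.
Proof.
pose E : 'M[R]_q := \matrix_(i, j) limn (pseries (coef 1%:M X i j) 1).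
suff sE : series (fun k => (k`!%:R)^-1 *: X ^+ k) n @[n --> \oo] --> E.
  by rewrite /expmx (cvg_lim _ sE).
apply/cvg_mxP => i j; rewrite mxE.
have := @is_cvg_pseries_coef 1%:M X i j 1; apply: cvg_trans.
apply: near_eq_cvg; near=> n; rewrite /pseries /series /= summxE.
by apply: eq_bigr => k _; rewrite mxE /coef expr1n mulr1 mul1mx.
Unshelve. all: by end_near. Qed.

Let cvg_pseries_coef C X i j s :
  pseries (coef C X i j) s n @[n --> \oo] --> (C *m expmx (s *: X)) i j.
Proof.
have : C *m (series (fun k => (k`!%:R)^-1 *: (s *: X) ^+ k) n) @[n --> \oo]
    --> (C *m expmx (s *: X)).
  by apply: cvg_mulmx; [exact: cvg_cst|exact: cvg_expmx].
move=> /cvg_mxP/(_ i j); apply: cvg_trans; apply: near_eq_cvg; near=> n.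
rewrite /pseries /series /= mulmx_sumr summxE.
apply: eq_bigr => k _; rewrite /coef expr_scalemx -!scalemxAr !mxE.
by rewrite -mulrA; congr (_ * _); rewrite mulrC.
Unshelve. all: by end_near. Qed.

Lemma expmx0 : expmx (0 : 'M[R]_q) = 1%:M.
Proof.
rewrite /expmx; apply: cvg_lim => //.
(* The shift by one skips the empty partial sum, which is 0; all later ones are the identity. *)
rewrite -(@cvg_shiftn 1); apply: cvg_near_cst; near=> n => /=.
rewrite /series /= addn1 big_nat_recl//= expr0 fact0 invr1 scale1r.
by rewrite big1 ?addr0// => i _; rewrite expr0n /= scaler0.
Unshelve. all: by end_near. Qed.

Lemma mulmx_expmxC X s : X *m expmx (s *: X) = expmx (s *: X) *m X.
Proof.
have Xs : X *m (series (fun k => (k`!%:R)^-1 *: (s *: X) ^+ k) n) @[n --> \oo]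
    --> (X *m expmx (s *: X)).
  by apply: cvg_mulmx; [exact: cvg_cst|exact: cvg_expmx].
rewrite -(cvg_lim _ Xs)//; apply: cvg_lim => //.
have : (series (fun k => (k`!%:R)^-1 *: (s *: X) ^+ k) n) *m X @[n --> \oo]
    --> (expmx (s *: X) *m X).
  by apply: cvg_mulmx; [exact: cvg_expmx|exact: cvg_cst].
apply: cvg_trans; apply: near_eq_cvg; near=> n; rewrite /series /=.
rewrite mulmx_sumr mulmx_suml; apply: eq_bigr => k _.
rewrite expr_scalemx -!scalemxAr -!scalemxAl; congr (_ *: (_ *: _)).
by rewrite !mulmxE -exprS -exprSr.
Unshelve. all: by end_near. Qed.

Lemma expmx_tr X : expmx X^T = (expmx X)^T.
Proof.
rewrite {1}/expmx; apply: cvg_lim => //.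
have /cvg_trmx := @cvg_expmx X; apply: cvg_trans; apply: near_eq_cvg; near=> n.
rewrite /series /= linear_sum; apply: eq_bigr => k _; rewrite linearZ /=.
by congr (_ *: _); elim: k => [|k IH]; rewrite ?expr0 ?trmx1// exprS exprSr trmx_mul IH.
Unshelve. all: by end_near. Qed.

Lemma is_derive_within_expmx D X s :
  is_derive_within D (fun r => expmx (r *: X)) s (X *m expmx (s *: X)).
Proof.
apply: is_derive_within_mx => i j.
(* Termwise differentiation asks that the series and its first two formal derivatives converge at a
   point of modulus greater than |s|; the point |s| + 1 is used. *)
have K : `|s| < `| `|s| + 1 | by rewrite [ltRHS]ger0_norm ?ltrDl ?addr_ge0.
have limE C r : limn (pseries (coef C X i j) r) = (C *m expmx (r *: X)) i j.
  by apply: cvg_lim => //; exact: cvg_pseries_coef.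
have := @pseries_snd_diffs _ (coef 1%:M X i j) (`|s| + 1) s _ _ _ K.
rewrite !pseries_diffs_coef mul1mx; have cvg := @is_cvg_pseries_coef.
move=> /(_ (cvg _ _ _ _ _) (cvg _ _ _ _ _) (cvg _ _ _ _ _)); rewrite limE.
by under [X in is_derive _ _ X _ -> _]eq_fun do rewrite limE mul1mx.
Qed.

(** As a function of [s] the product has zero derivative, because [X] commutes with its
    exponentials, so it keeps its value at 0. *)
Lemma expmxN X s : expmx (s *: - X) *m expmx (s *: X) = 1%:M.
Proof.
pose f r := expmx (r *: - X) *m expmx (r *: X).
have f' r : is_derive_within setT f r 0.
  have := is_derive_within_mulmx (@is_derive_within_expmx setT (- X) r)
    (@is_derive_within_expmx setT X r).
  rewrite mulmx_expmxC mulmxN mulNmx -mulmxA.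
  by rewrite [X in X + _](_ : _ = - (expmx (r *: - X) *m (X *m expmx (r *: X)))) ?addNr.
have <- : f 0 = 1%:M by rewrite /f !scale0r expmx0 mulmx1.
apply/matrixP => i j; apply: (@is_derive_0_is_cst _ (fun r => f r i j)) => r.
have := @is_derive_within_entry _ _ _ _ _ _ _ i j (f' r); rewrite mxE.
by apply: is_derive_withinE; exact: filterT.
Qed.

End Expmx.

(** * Quadratic forms *)

Section QuadraticForms.
Variable R : realType.

Definition dot q (u v : 'cV[R]_q) : R := (u^T *m v) 0 0.

Lemma dotC q (u v : 'cV[R]_q) : dot u v = dot v u.
Proof. by rewrite /dot -[u^T *m v]trmxK trmx_mul trmxK mxE. Qed.

Lemma dotDr q (u v w : 'cV[R]_q) : dot u (v + w) = dot u v + dot u w.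
Proof. by rewrite /dot mulmxDr mxE. Qed.

Lemma dotNr q (u v : 'cV[R]_q) : dot u (- v) = - dot u v.
Proof. by rewrite /dot mulmxN mxE. Qed.

Lemma dotZr q c (u v : 'cV[R]_q) : dot u (c *: v) = c * dot u v.
Proof. by rewrite /dot -scalemxAr mxE. Qed.

Lemma dotDl q (u v w : 'cV[R]_q) : dot (v + w) u = dot v u + dot w u.
Proof. by rewrite dotC dotDr !(dotC u). Qed.

Lemma dotZl q c (u v : 'cV[R]_q) : dot (c *: u) v = c * dot u v.
Proof. by rewrite dotC dotZr dotC. Qed.

Lemma dot_mull p q (M : 'M[R]_(p, q)) u v : dot (M *m u) v = dot u (M^T *m v).
Proof. by rewrite /dot trmx_mul mulmxA. Qed.

Lemma dot_col_mx p q (a c : 'cV[R]_p) (b d : 'cV[R]_q) :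
  dot (col_mx a b) (col_mx c d) = dot a c + dot b d.
Proof. by rewrite /dot tr_col_mx mul_row_col mxE. Qed.

Lemma dotE q (u : 'cV[R]_q) : dot u u = \sum_i u i 0 ^+ 2.
Proof. by rewrite /dot mxE; apply: eq_bigr => i _; rewrite mxE expr2. Qed.

(** Together with the next bound, this compares the squared Euclidean length with the largest-entry
    norm. The maximum is attained at some entry, whose square is one term of the sum. *)
Lemma dot_ge_norm q (u : 'cV[R]_q) : `|u| ^+ 2 <= dot u u.
Proof.
have -> : `|u| = mx_norm u by [].
have [->|/mx_norm_neq0[[i j] /= ->]] := eqVneq (mx_norm u) 0.
  by rewrite expr0n dotE sumr_ge0// => i _; exact: sqr_ge0.
rewrite real_normK ?num_real// dotE (bigD1 i)//= ord1 lerDl.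
by apply: sumr_ge0 => k _; exact: sqr_ge0.
Qed.

Lemma dot_le_norm q (u : 'cV[R]_q) : dot u u <= q%:R * `|u| ^+ 2.
Proof.
rewrite dotE mulr_natl -[X in _ *+ X]card_ord -sumr_const; apply: ler_sum => i _.
by rewrite -real_normK ?num_real// ler_sqr ?nnegrE// ler_mx_entry.
Qed.

Lemma qformE q (X : 'M[R]_q) v : qform X v = dot v (X *m v).
Proof. by rewrite /qform /dot mulmxA. Qed.

Lemma qformD q (X Y : 'M[R]_q) v : qform (X + Y) v = qform X v + qform Y v.
Proof. by rewrite !qformE mulmxDl dotDr. Qed.

Lemma qformN q (X : 'M[R]_q) v : qform (- X) v = - qform X v.
Proof. by rewrite !qformE mulNmx dotNr. Qed.

Lemma qformZ q c (X : 'M[R]_q) v : qform (c *: X) v = c * qform X v.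
Proof. by rewrite !qformE -scalemxAl dotZr. Qed.

Lemma qform0 q v : qform (0 : 'M[R]_q) v = 0.
Proof. by rewrite qformE mul0mx /dot mulmx0 mxE. Qed.

Lemma qform_sum q (I : finType) (X : I -> 'M[R]_q) v :
  qform (\sum_i X i) v = \sum_i qform (X i) v.
Proof.
by elim/big_rec2: _ => [|i _ Y _ <-]; [exact: qform0|exact: qformD].
Qed.

Lemma qform_scalar_mx q c (v : 'cV[R]_q) : qform c%:M v = c * dot v v.
Proof. by rewrite qformE mul_scalar_mx dotZr. Qed.

Lemma qform_conj p q (Y : 'M[R]_(p, q)) X v :
  qform (Y^T *m X *m Y) v = qform X (Y *m v).
Proof. by rewrite !qformE dot_mull !mulmxA. Qed.

Lemma qformZv q (X : 'M[R]_q) c v : qform X (c *: v) = c ^+ 2 * qform X v.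
Proof. by rewrite !qformE -scalemxAr dotZr dotZl mulrA expr2. Qed.

Lemma qformNv q (X : 'M[R]_q) v : qform X (- v) = qform X v.
Proof. by rewrite -scaleN1r qformZv sqrrN expr1n mul1r. Qed.

Lemma symmetricmxP q (X : 'M[R]_q) : reflect (X^T = X) (X \is symmetricmx).
Proof.
apply: (iffP idP) => [/is_hermitianmxP|XX].
  by rewrite expr0 scale1r map_mx_id// => {2}->.
by apply/is_hermitianmxP; rewrite expr0 scale1r map_mx_id// XX.
Qed.

Lemma qformDv q (X : 'M[R]_q) u v : X^T = X ->
  qform X (u + v) = qform X u + 2 * dot u (X *m v) + qform X v.
Proof.
move=> XX; rewrite !qformE mulmxDr !dotDl !dotDr.
by rewrite -[X in dot v (X *m u)]XX -dot_mull (dotC (X *m v)); ring.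
Qed.

Lemma qform_conj_sym p q (Y : 'M[R]_(p, q)) X : X^T = X ->
  (Y^T *m X *m Y)^T = Y^T *m X *m Y.
Proof. by move=> XX; rewrite !trmx_mul trmxK XX mulmxA. Qed.

Section Posdef.
Variables (q : nat) (X : 'M[R]_q).
Hypothesis X0 : posdef X.

Lemma posdef_sym : X^T = X.
Proof. by case: X0 => /symmetricmxP. Qed.

Lemma posdef_ge0 v : 0 <= qform X v.
Proof.
have [->|v0] := eqVneq v 0; last by case: X0 => _ /(_ v v0)/ltW.
by rewrite qformE mulmx0 /dot mulmx0 mxE.
Qed.

(** A nonzero row of the left kernel would be a nonzero vector with vanishing quadratic form. *)
Lemma posdef_unitmx : X \in unitmx.
Proof.
rewrite -row_free_unit -kermx_eq0; apply/eqP/row_matrixP => i; rewrite row0.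
apply/eqP/contraT => ki0; have := X0.2 (row i (kermx X))^T.
rewrite -(inj_eq trmx_inj) trmxK trmx0 => /(_ ki0).
by rewrite /qform trmxK -row_mul mulmx_ker row0 mul0mx mxE ltxx.
Qed.

Lemma invmx_sym : (invmx X)^T = invmx X.
Proof. by rewrite trmx_inv posdef_sym. Qed.

Lemma qform_invmx v : qform (invmx X) (X *m v) = qform X v.
Proof. by rewrite !qformE mulKmx ?posdef_unitmx// dotC. Qed.

Lemma posdef_invmx : posdef (invmx X).
Proof.
split; first exact/symmetricmxP/invmx_sym.
move=> v v0; have vE : v = X *m (invmx X *m v) by rewrite mulKVmx ?posdef_unitmx.
rewrite {1}vE qform_invmx; apply: X0.2; apply: contra v0 => /eqP v0.
by rewrite vE v0 mulmx0.
Qed.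

End Posdef.

Lemma colstochastic_sum N (Pi : 'M[R]_N) i :
  nonneg_colstochastic Pi -> \sum_j Pi j i = 1.
Proof.
case=> _ /rowP/(_ i); rewrite !mxE => <-.
by apply: eq_bigr => j _; rewrite mxE mul1r.
Qed.

Lemma posdef_mix q N (Pi : 'M[R]_N) (P : 'I_N -> 'M[R]_q) i :
  nonneg_colstochastic Pi -> (forall j, posdef (P j)) ->
  posdef (\sum_j Pi j i *: P j).
Proof.
move=> Pi0 P0; split.
  apply/symmetricmxP; rewrite linear_sum; apply: eq_bigr => j _.
  by rewrite linearZ /= posdef_sym.
move=> v v0; rewrite qform_sum; under eq_bigr do rewrite qformZ.
have ge0 j : true -> 0 <= Pi j i * qform (P j) v.
  by move=> _; rewrite mulr_ge0 ?posdef_ge0//; exact: Pi0.1.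
(* If the sum vanished, so would every term, hence every weight, against the column sum 1. *)
rewrite lt_def sumr_ge0// andbT; apply/eqP => /(psumr_eq0P ge0) s0.
have := colstochastic_sum i Pi0; rewrite big1 => [/eqP|j _].
  by rewrite eq_sym oner_eq0.
have /eqP := s0 j isT; rewrite mulf_eq0 => /orP[/eqP//|].
by rewrite gt_eqF//; exact: (P0 j).2.
Qed.

(* The substitution [z = pt *m v] plays the role of a Schur complement, which
   would require inverting [s]. *)
Lemma negdef_blockP q (pt jb s : 'M[R]_q) : posdef pt -> s^T = s ->
  negdef (block_mx (- pt) (jb *m pt)^T (jb *m pt) (- s)) <->
  forall z w, col_mx z w != 0 ->
    2 * dot w (jb *m z) - qform s w < qform (invmx pt) z.
Proof.
move=> pt0 ss; have ptu := posdef_unitmx pt0.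
have blockE v w : qform (block_mx (- pt) (jb *m pt)^T (jb *m pt) (- s)) (col_mx v w)
    = 2 * dot w (jb *m (pt *m v)) - qform s w - qform (invmx pt) (pt *m v).
  rewrite qform_invmx// !qformE mul_block_col dot_col_mx !dotDr !mulNmx !dotNr.
  rewrite -dot_mull (dotC (jb *m pt *m v)) -mulmxA; ring.
split=> [[_ neg] z w zw0|h].
  rewrite -subr_lt0 -[z](mulKVmx ptu) -blockE; apply: neg.
  apply: contra zw0; rewrite !col_mx_eq0 => /andP[/eqP z0 ->].
  by rewrite -[z](mulKVmx ptu) z0 mulmx0 eqxx.
split.
  by apply/symmetricmxP; rewrite tr_block_mx !linearN /= trmxK ss posdef_sym.
move=> v; rewrite -[v]vsubmxK => vw0; rewrite blockE subr_lt0; apply: h.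
apply: contra vw0; rewrite !col_mx_eq0 => /andP[/eqP z0 ->].
by rewrite -[usubmx v](mulKmx ptu) z0 mulmx0 eqxx.
Qed.

(** * The block-diagonal inequality and the mixture of the inverses *)

Section Mixture.
Variables (n m N : nat) (Pi : 'M[R]_N) (i : 'I_N).
Local Notation q := (n + m)%N.
Variable pt : 'I_N -> 'M[R]_q.
Hypotheses (Pi0 : forall i j, 0 <= Pi i j) (pt0 : forall j, posdef (pt j)).

Let V := Vcol n m Pi i.
Let D := \mxdiag_(j < N) invmx (pt j).
Let M := \sum_(j < N) Pi j i *: invmx (pt j).

(** Each weight arises as the square of a square root in [V], by nonnegativity of [Pi]. *)
Let VDV : V^T *m D *m V = M.
Proof.
rewrite /V /Vcol tr_mxcol mul_mxrow_mxdiag mul_mxrow_mxcol; apply: eq_bigr => j _.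
rewrite tr_scalar_mx mul_scalar_mx mul_mx_scalar scalerA -expr2 sqr_sqrtr//.
Qed.

Let DK : \mxdiag_(j < N) pt j *m D = 1%:M.
Proof.
rewrite /D {2}/mxdiag mul_mxdiag_mxblock -mxdiagZ /mxdiag.
apply/eq_mxblock => j k; case: eqVneq => [->|_]; last by rewrite mulmx0.
by rewrite !conform_mx_id mulmxV// posdef_unitmx.
Qed.

Let Dsym : D^T = D.
Proof. by rewrite /D tr_mxdiag; apply/eq_mxdiag => j; exact: invmx_sym. Qed.

Let D_ge0 v : 0 <= qform D v.
Proof.
rewrite -[v]submxcolK qformE /D mul_mxdiag_mxcol /dot tr_mxcol mul_mxrow_mxcol.
rewrite summxE sumr_ge0// => j _; rewrite mulmxA.
exact/posdef_ge0/posdef_invmx.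
Qed.

Let blockE (s : 'M[R]_q) v :
  qform (- (\mxdiag_(j < N) pt j) + V *m s *m V^T) v
    = qform s (V^T *m v) - qform (\mxdiag_(j < N) pt j) v.
Proof. by rewrite qformD qformN addrC -[V in V *m s]trmxK qform_conj. Qed.

(** The test vector is D V a: [VDV] turns V^T D V a into M a, and as [D] inverts the block-diagonal
    matrix, the form of the latter at D V a is a^T M a. *)
Lemma mixture_le (s : 'M[R]_q) :
  negsemidef (- (\mxdiag_(j < N) pt j) + V *m s *m V^T) ->
  forall a, qform s (M *m a) <= qform M a.
Proof.
move=> [_ neg] a; have := neg (D *m V *m a); rewrite blockE subr_le0.
rewrite !mulmxA VDV => /le_trans; apply.
by rewrite -VDV qform_conj !qformE -!mulmxA [X in dot _ X]mulmxA DK mul1mx mulmxA dotC.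
Qed.

(** Completion of the square: with b = V^T v, c = M^-1 b and z = D^-1 v, the nonnegative value of
    [D] at z - V c equals v^T D^-1 v - b^T M^-1 b. *)
Lemma negsemidef_mixture : posdef M ->
  negsemidef (- (\mxdiag_(j < N) pt j) + V *m invmx M *m V^T).
Proof.
move=> M0; have Mu := posdef_unitmx M0; split.
  apply/symmetricmxP; rewrite linearD linearN /= tr_mxdiag.
  rewrite (eq_mxdiag (fun j => posdef_sym (pt0 j))).
  by have := qform_conj_sym V^T (invmx_sym M0); rewrite trmxK => ->.
move=> v; rewrite blockE subr_le0.
pose b := V^T *m v; pose c := invmx M *m b; pose z := \mxdiag_(j < N) pt j *m v.
have vE : v = D *m z by rewrite mulmxA (mulmx1C DK) mul1mx.
have := D_ge0 (z - V *m c); rewrite qformDv// mulmxN dotNr.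
have -> : qform D (- (V *m c)) = dot b c.
  by rewrite qformNv -qform_conj VDV qformE mulKVmx// dotC.
have -> : dot z (D *m (V *m c)) = dot b c.
  by rewrite -{1}Dsym -dot_mull -vE dotC dot_mull dotC.
have -> : qform D z = qform (\mxdiag_(j < N) pt j) v.
  by rewrite !qformE -vE dotC.
by rewrite -/b [qform (invmx M) b]qformE -/c; lra.
Qed.

End Mixture.

End QuadraticForms.

(** * Differential Lyapunov inequality *)

Section LyapunovInequality.
Variable R : realType.

Lemma is_derive_within_qform D q (H : R -> 'M[R]_q) x dH v :
  is_derive_within D H x dH ->
  is_derive_within D (fun y => qform (H y) v) x (qform dH v).
Proof.
move=> Hx; rewrite /qform.
have := is_derive_within_mulmx (is_derive_within_mulmx
  (is_derive_within_cst D v^T x) Hx) (is_derive_within_cst D v x).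
by rewrite mul0mx add0r mulmx0 addr0; exact: is_derive_within_entry.
Qed.

(** The function exp(s G)^T S(s) exp(s G) has as derivative the congruence of G^T S + S' + S G by
    exp(s G), so its quadratic forms are nondecreasing. It serves (b) with G = -F, and (c) with G =
    F^T and -S in place of S, where F is [Abar]. *)
Lemma lyapunov_le q (G : 'M[R]_q) (S dS : R -> 'M[R]_q) T :
  (forall s, s \in `[0, T] -> is_derive_within `[0, T] S s (dS s)) ->
  (forall s v, s \in `[0, T] -> 0 <= qform (G^T *m S s + dS s + S s *m G) v) ->
  forall s v, s \in `[0, T] -> qform (S 0) v <= qform (S s) (expmx (s *: G) *m v).
Proof.
move=> Sd S0 s v; rewrite in_itv /= => /andP[s0 sT].
pose Y r := expmx (r *: G); pose H r := (Y r)^T *m S r *m Y r.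
have HE r : qform (H r) v = qform (S r) (Y r *m v) by rewrite qform_conj.
have -> : qform (S 0) v = qform (H 0) v by rewrite HE /Y scale0r expmx0 mul1mx.
rewrite -HE.
have sub r : 0 <= r <= s -> r \in `[0, T].
  by rewrite in_itv /= => /andP[-> /le_trans->].
apply: (@is_derive_within_le_cc _ (fun r => qform (H r) v)
  (fun r => qform (G^T *m S r + dS r + S r *m G) (Y r *m v))) => // r rs.
  have Yr := @is_derive_within_expmx _ _ `[0, s] G r.
  have Sr : is_derive_within `[0, s] S r (dS r).
    by apply: is_derive_withinW (Sd _ (sub _ rs)); exact: subset_itvl.
  have := @is_derive_within_qform _ _ _ _ _ v (is_derive_within_mulmx
    (is_derive_within_mulmx (is_derive_within_trmx Yr) Sr) Yr).
  congr is_derive_within; rewrite -qform_conj; congr (qform _ v).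
  by rewrite -/(Y r) trmx_mul !(mulmxDl, mulmxDr, mulmxA).
exact/S0/sub.
Qed.

Lemma expmx_continuous q (X : 'M[R]_q) : continuous (fun s : R => expmx (s *: X)).
Proof.
move=> s A As; have := is_derive_within_cvg (@is_derive_within_expmx _ _ setT X s).
move=> /(_ A As) [e /= e0 eA]; exists e => //= y sy.
by have [->|ys] := eqVneq y s; [exact: nbhs_singleton As|exact: eA].
Qed.

(** By homogeneity the constant is the minimum of the form over [a, b] times the unit sphere, which
    is compact. The sphere is made of row vectors, to which [bounded_closed_compact] applies. *)
Lemma uniform_posdef q (G : R -> 'M[R]_q) (a b : R) : continuous G ->
  (forall s v, a <= s <= b -> v != 0 -> 0 < qform (G s) v) ->
  exists2 e, 0 < e & forall s v, a <= s <= b -> e * `|v| ^+ 2 <= qform (G s) v.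
Proof.
move=> Gc G0; pose K := `[a, b] `*` [set v : 'rV[R]_q | `|v| = 1].
pose f (p : R * 'rV[R]_q) := qform (G p.1) p.2^T.
have fc : continuous f.
  move=> p; rewrite /f /qform.
  have c1 : G p'.1 @[p' --> p] --> G p.1.
    by apply: (cvg_comp fst G); [exact: cvg_fst|exact: Gc].
  have c2 : p'.2 @[p' --> p] --> p.2 by exact: cvg_snd.
  under eq_fun do rewrite trmxK.
  have : (p'.2 *m G p'.1 *m p'.2^T) @[p' --> p] --> (p.2 *m G p.1 *m p.2^T).
    by apply: cvg_mulmx; [exact: cvg_mulmx|exact: cvg_trmx].
  by move=> /cvg_mxP/(_ 0 0).
have Kc : compact K.
  apply: compact_setX; first exact: segment_compact.
  apply: bounded_closed_compact.
    by exists 1; split; [exact: num_real|move=> c c1 v /= ->; exact: ltW].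
  apply: (@closed_comp _ _ (fun v : 'rV[R]_q => `|v|) [set 1]).
    by move=> v _; exact: norm_continuous.
  exact: closed_eq.
have unit s (v : 'cV[R]_q) : a <= s <= b -> v != 0 -> K (s, `|v|^-1 *: v^T).
  move=> sab v0; split => //=.
  by rewrite normrZ norm_trmx normfV normr_id mulVf// normr_eq0.
have scale s (v : 'cV[R]_q) : v != 0 ->
    qform (G s) v = `|v| ^+ 2 * f (s, `|v|^-1 *: v^T).
  move=> v0; rewrite /f /= linearZ /= trmxK qformZv mulrA -exprMn mulfV ?normr_eq0//.
  by rewrite expr1n mul1r.
have q0 s (v : 'cV[R]_q) : v = 0 -> qform (G s) v = 0.
  by move=> ->; rewrite qformE mulmx0 /dot mulmx0 mxE.
(* The compact set is empty when b < a or q = 0; then the bound with constant 1 is only ever asked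
   at v = 0. *)
have [K0|K0] := pselect (K !=set0).
  have [[s0 v0]] := compact_EVT_min K0 Kc (continuous_subspaceT fc).
  rewrite inE => -[/= s0ab v01] fmin.
  exists (f (s0, v0)).
    apply: G0 => //; rewrite -normr_eq0.
    by rewrite -(norm_trmx v0^T) trmxK v01 oner_eq0.
  move=> s v sab; have [v00|vn0] := eqVneq v 0.
    by rewrite q0// v00 normr0 expr0n mulr0.
  rewrite scale// mulrC ler_wpM2l ?sqr_ge0//; apply: fmin.
  by rewrite inE; exact: unit.
exists 1 => // s v sab; have [v00|vn0] := eqVneq v 0.
  by rewrite q0// v00 normr0 expr0n mulr0.
by exfalso; apply: K0; eexists; exact: unit sab vn0.
Qed.

(** Since each [p i] passes to smaller constants, the minimum of finitely many witnesses works; the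
    1 is its value on an empty index type. *)
Lemma finite_pos_lower_bound (I : finType) (p : I -> R -> Prop) :
  (forall i e e', p i e -> e' <= e -> p i e') ->
  (forall i, exists2 e, 0 < e & p i e) -> exists2 e, 0 < e & forall i, p i e.
Proof.
move=> ple pe; have [e ep] : {e : I -> R & forall i, 0 < e i /\ p i (e i)}.
  apply: (@boolp.choice I R (fun i e => 0 < e /\ p i e)) => i.
  by have [x x0 px] := pe i; exists x.
exists (\big[Num.min/1]_i e i).
  by apply: lt_bigmin => // i _; case: (ep i).
by move=> i; apply: ple (ep i).2 _; apply/bigmin_leP; right; exists i.
Qed.
End LyapunovInequality.

(** * Equivalence of the matrix inequalities *)

Section Conditions.
Variables (R : realType) (n m N : nat).
Variables (A : 'M[R]_n) (B : 'M[R]_(n, m)) (J : 'I_N -> 'M[R]_n).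
Variables (Tmin Tmax : R).
Hypothesis Tmin0 : 0 < Tmin.

Local Notation q := (n + m)%N.

Let expmxZ_tr (F : 'M[R]_q) s : expmx (s *: F^T) = (expmx (s *: F))^T.
Proof. by rewrite -expmx_tr linearZ. Qed.

Let dwell_range theta : theta \in `[Tmin, Tmax] -> theta \in `[0, Tmax].
Proof. by rewrite !in_itv /= => /andP[/(le_trans (ltW Tmin0)) -> ->]. Qed.

Let sym_mix (Pi : 'M[R]_N) (P : 'I_N -> 'M[R]_q) i :
  (forall j, posdef (P j)) ->
  (\sum_(j < N) Pi j i *: P j)^T = \sum_(j < N) Pi j i *: P j.
Proof.
move=> P0; rewrite linear_sum; apply: eq_bigr => j _.
by rewrite linearZ /= posdef_sym.
Qed.

(** Vector form of the inequality of (a), in which all implications below are argued; the symmetry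
    required by [negsemidef] follows from that of [M] and [P]. *)
Let lmi_aP (F jb M P : 'M[R]_q) theta eps : M^T = M -> P^T = P ->
  negsemidef (jb^T *m expmx (theta *: F^T) *m M *m expmx (theta *: F) *m jb
    - P + eps%:M) <->
  forall v, qform M (expmx (theta *: F) *m (jb *m v)) + eps * dot v v <= qform P v.
Proof.
move=> MM PP; rewrite expmxZ_tr; set E := expmx (theta *: F).
have -> : jb^T *m (E)^T *m M *m E *m jb
    = (E *m jb)^T *m M *m (E *m jb) by rewrite trmx_mul !mulmxA.
have qE v : qform ((E *m jb)^T *m M *m (E *m jb) - P + eps%:M) v
    = qform M (E *m (jb *m v)) + eps * dot v v - qform P v.
  by rewrite !qformD qformN qform_conj qform_scalar_mx -mulmxA; ring.
split=> [[_ neg] v|le]; first by rewrite -subr_le0 -qE.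
split=> [|v]; last by rewrite qE subr_le0.
apply/symmetricmxP; rewrite !linearD linearN /= qform_conj_sym// PP.
by rewrite tr_scalar_mx.
Qed.

Lemma cond_a_to_b P K Pi eps : cond_a A B J Tmin Tmax P K Pi eps ->
  exists S dS, cond_b A B J Tmin Tmax S dS P K Pi eps.
Proof.
rewrite /cond_a /cond_b; move: (Abar A B) => F.
pose E s := expmx (s *: F).
move=> [P0 Pi0 eps0 lmi].
pose M i := \sum_(j < N) Pi j i *: P j.
have MM i : (M i)^T = M i by exact: sym_mix.
pose S i s := (E s)^T *m M i *m E s.
have SS i s : (S i s)^T = S i s by exact: qform_conj_sym.
exists S, (fun i s => F^T *m S i s + S i s *m F); split => //.
  move=> i s _; split; first exact/symmetricmxP.
  have Es := @is_derive_within_expmx _ _ `[0, Tmax] F s.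
  have := is_derive_within_mulmx (is_derive_within_mulmx
    (is_derive_within_trmx Es) (is_derive_within_cst _ (M i) s)) Es.
  congr is_derive_within.
  (* With E' = F E rewritten as E F, the derivative of E^T M E becomes F^T S + S F. *)
  have EF : F *m E s = E s *m F by exact: mulmx_expmxC.
  by rewrite mulmx0 addr0 -/(E s) EF trmx_mul !mulmxA.
move=> i; split.
- move=> s _; rewrite -addrA addNr; split; last by move=> v; rewrite qform0.
  by apply/symmetricmxP; rewrite linear0.
- move=> theta thetaT.
  have /lmi_aP := lmi i theta thetaT.
  move=> /(_ (MM i) (posdef_sym (P0 i))) le; split.
    apply/symmetricmxP; rewrite !linearD linearN /= qform_conj_sym//.
    by rewrite posdef_sym// tr_scalar_mx.
  move=> v; rewrite !qformD qformN qform_conj qform_scalar_mx qform_conj.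
  by have := le v; lra.
- rewrite /S /E scale0r expmx0 trmx1 mul1mx mulmx1 subrr.
  split; last by move=> v; rewrite qform0.
  by apply/symmetricmxP; rewrite linear0.
Qed.

Lemma cond_b_to_a S dS P K Pi eps : cond_b A B J Tmin Tmax S dS P K Pi eps ->
  cond_a A B J Tmin Tmax P K Pi eps.
Proof.
rewrite /cond_a /cond_b; move: (Abar A B) => F.
pose E s := expmx (s *: F).
move=> [P0 Pi0 eps0 Sd lmi]; split=> // i theta thetaT.
have [lmi1 lmi2 lmi3] := lmi i.
apply/lmi_aP; [exact: sym_mix|exact: posdef_sym|] => v.
have /= le0 := @lyapunov_le _ _ (- F) (S i) (dS i) Tmax.
have {}le0 := le0 (fun s sT => (Sd i s sT).2).
have {}le0 s w : s \in `[0, Tmax] ->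
    qform (S i 0) w <= qform (S i s) (expmx (s *: - F) *m w).
  apply: le0 => {}s {}w sT; have [_ /(_ w)] := lmi1 s sT.
  by rewrite linearN /= !qformD mulNmx mulmxN !qformN; lra.
set y := Jbar J K i *m v.
(* The monotonicity is applied at E(theta) y, which E(-theta) carries back to y. *)
have le1 : qform (S i 0) (E theta *m y) <= qform (S i theta) y.
  have EK : expmx (theta *: - F) *m (E theta *m y) = y.
    by rewrite mulmxA [X in X *m y]expmxN mul1mx.
  by rewrite -[in leRHS]EK; apply: le0; exact: dwell_range.
have [_ /(_ v)] := lmi2 theta thetaT.
rewrite !qformD qformN qform_conj qform_scalar_mx => le2.
have [_ /(_ (E theta *m y))] := lmi3.
by rewrite qformD qformN => le3; lra.
Qed.

Lemma cond_a_to_c P K Pi eps : cond_a A B J Tmin Tmax P K Pi eps ->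
  exists S dS, cond_c A B J Tmin Tmax S dS (fun i => invmx (P i))
    (fun i => K i *m invmx (P i)) Pi eps.
Proof.
rewrite /cond_a /cond_c; move: (Abar A B) => F.
pose E s := expmx (s *: F).
move=> [P0 Pi0 eps0 lmi].
pose M i := \sum_(j < N) Pi j i *: P j.
have M0 i : posdef (M i) by exact: posdef_mix.
pose En s := expmx (s *: - F).
have EnE s : En s *m E s = 1%:M by exact: expmxN.
(* This is the inverse of E^T M E, written with E(-s). *)
pose S i s := En s *m invmx (M i) *m (En s)^T.
have SS i s : (S i s)^T = S i s.
  by rewrite /S !trmx_mul trmxK invmx_sym// mulmxA.
exists S, (fun i s => - (S i s *m F^T + F *m S i s)).
have iP0 i : posdef (invmx (P i)) by exact: posdef_invmx.
split=> //.
  move=> i s _; split; first exact/symmetricmxP.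
  have Es := @is_derive_within_expmx _ _ `[0, Tmax] (- F) s.
  have := is_derive_within_mulmx (is_derive_within_mulmx
    Es (is_derive_within_cst _ (invmx (M i)) s)) (is_derive_within_trmx Es).
  congr is_derive_within.
  rewrite mulmx0 addr0 -/(En s) trmx_mul [(- F)^T]raddfN.
  by rewrite !mulNmx !mulmxN opprD addrC !mulmxA.
move=> i; split.
- move=> s _; rewrite -addrA addNr; split; last by move=> v; rewrite qform0.
  by apply/symmetricmxP; rewrite linear0.
- move=> theta thetaT.
  have -> : Jbar0 m J i *m invmx (P i) + Jbar1 R n m *m (K i *m invmx (P i))
      = Jbar J K i *m invmx (P i) by rewrite JbarE mulmxDl mulmxA.
  apply/negdef_blockP => //.
  have /lmi_aP := lmi i theta thetaT.
  move=> /(_ (posdef_sym (M0 i)) (posdef_sym (P0 i))) le z w zw0.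
  (* In these variables the goal reads 2 b^T a - b^T c < z^T P z, where b = M c. *)
  pose b := (En theta)^T *m w; pose c := invmx (M i) *m b.
  pose a := E theta *m (Jbar J K i *m z).
  have MC : M i *m c = b by rewrite mulKVmx// posdef_unitmx.
  have -> : qform (S i theta) w = dot b c.
    by rewrite /S -[X in X *m _ *m _]trmxK qform_conj qformE.
  have -> : dot w (Jbar J K i *m z) = dot b a.
    by rewrite dot_mull trmxK mulmxA EnE mul1mx.
  rewrite invmxK; have := le z; rewrite -/a => lez.
  (* For z nonzero, the form of [M] at a - c is nonnegative and [eps] makes the inequality strict.
     For z = 0 strictness comes from b^T M^-1 b > 0, as w is nonzero. *)
  have [z0|zn0] := eqVneq z 0; last first.
    have := posdef_ge0 (M0 i) (a - c); rewrite qformDv ?(posdef_sym (M0 i))//.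
    rewrite mulmxN dotNr MC qformNv.
    rewrite [qform (M i) c]qformE MC (dotC c) (dotC a).
    have zz : 0 < eps * dot z z.
      by rewrite mulr_gt0// (lt_le_trans _ (dot_ge_norm z))// exprn_gt0 ?normr_gt0.
    lra.
  have w0 : w != 0 by move: zw0; rewrite col_mx_eq0 z0 eqxx.
  have -> : a = 0 by rewrite /a z0 !mulmx0.
  rewrite z0 qformE mulmx0 /dot !mulmx0 mxE -/(dot b c) mulr0 sub0r oppr_lt0.
  rewrite -qformE; apply: (posdef_invmx (M0 i)).2; apply: contra w0 => /eqP b0.
  have := congr1 (mulmx (E theta)^T) b0.
  by rewrite mulmx0 mulmxA -trmx_mul EnE trmx1 mul1mx => ->.
- rewrite /S /En scale0r expmx0 trmx1 mul1mx mulmx1.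
  have -> : M i = \sum_(j < N) Pi j i *: invmx (invmx (P j)).
    by apply: eq_bigr => j _; rewrite invmxK.
  apply: negsemidef_mixture => //; first exact: Pi0.1.
  by under eq_bigr do rewrite invmxK; exact: M0.
Qed.

Lemma cond_c_to_a S dS Pt U Pi eps : cond_c A B J Tmin Tmax S dS Pt U Pi eps ->
  exists eps', cond_a A B J Tmin Tmax (fun i => invmx (Pt i))
    (fun i => U i *m invmx (Pt i)) Pi eps'.
Proof.
rewrite /cond_a /cond_c; move: (Abar A B) => F.
pose E s := expmx (s *: F).
move=> [P0 Pi0 eps0 Sd lmi].
have iP0 i : posdef (invmx (Pt i)) by exact: posdef_invmx.
set K := fun i => U i *m invmx (Pt i).
pose M i := \sum_(j < N) Pi j i *: invmx (Pt j).
have MM i : (M i)^T = M i by exact: sym_mix.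
pose Y i s := E s *m Jbar J K i.
(* The gap in the inequality of (a): strictly positive at each time by [G0], then uniformly so by
   compactness. *)
pose G i s := invmx (Pt i) - (Y i s)^T *m M i *m Y i s.
have GE i s v : qform (G i s) v = qform (invmx (Pt i)) v - qform (M i) (Y i s *m v).
  by rewrite qformD qformN qform_conj.
have G0 i s v : Tmin <= s <= Tmax -> v != 0 -> 0 < qform (G i s) v.
  move=> sT v0; rewrite GE subr_gt0.
  have [lmi1 lmi2 lmi3] := lmi i.
  have := lmi2 s sT.
  have -> : Jbar0 m J i *m Pt i + Jbar1 R n m *m U i = Jbar J K i *m Pt i.
    by rewrite JbarE mulmxDl -!mulmxA mulVmx ?mulmx1// posdef_unitmx.
  have SS r : r \in `[0, Tmax] -> (S i r)^T = S i r.
    by move=> rT; have [/symmetricmxP] := Sd i r rT.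
  have s0T : s \in `[0, Tmax] by exact: dwell_range.
  move=> /negdef_blockP => /(_ (P0 i) (SS s s0T)) lt1.
  (* With w = E^T y, the cross term w^T Jbar v equals m, the value of [M] at Y v. The inequalities
     [le3] and [le4] bound the form of S at w by m too, so the block inequality leaves m < v^T P
     v. *)
  pose y := M i *m (Y i s *m v).
  have := lt1 v ((E s)^T *m y); rewrite col_mx_eq0 negb_and v0 => /(_ isT).
  rewrite dot_mull trmxK mulmxA -/(Y i s) /y dotC -qformE => lt2.
  have le3 : qform (S i s) ((E s)^T *m y) <= qform (S i 0) y.
    have := @lyapunov_le _ _ F^T (fun s => - S i s) (fun s => - dS i s) Tmax.
    have Sd' r : r \in `[0, Tmax] ->
        is_derive_within `[0, Tmax] (fun s => - S i s) r (- dS i r).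
      by move=> rT; apply: is_derive_withinN; exact: (Sd i r rT).2.
    move=> /(_ Sd') /(_ _ s y s0T); rewrite !qformN lerN2 expmxZ_tr; apply.
    move=> r w rT; have [_ /(_ w)] := lmi1 r rT.
    by rewrite trmxK !qformD mulmxN mulNmx !qformN; lra.
  have le4 : qform (S i 0) y <= qform (M i) (Y i s *m v).
    by apply: mixture_le lmi3 _ => //; exact: Pi0.1.
  by rewrite -/y in lt2; lra.
have Gc i : continuous (G i).
  move=> s.
  have Yc : Y i r @[r --> s] --> Y i s.
    by apply: cvg_mulmx; [exact: expmx_continuous|exact: cvg_cst].
  apply: cvgB; first exact: cvg_cst.
  apply: cvg_mulmx => //; apply: cvg_mulmx; last exact: cvg_cst.
  exact: cvg_trmx.
have [e e0 eG] : exists2 e, 0 < e &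
    forall i s v, Tmin <= s <= Tmax -> e * `|v| ^+ 2 <= qform (G i s) v.
  apply: finite_pos_lower_bound => [i e e' eG e'e s v sT|i].
    by apply: le_trans (eG s v sT); rewrite ler_wpM2r// sqr_ge0.
  exact: uniform_posdef (Gc i) (G0 i).
(* The division pays for [dot v v] being at most q |v|^2; the successor keeps the denominator
   nonzero. *)
exists (e / q.+1%:R); split=> //.
  by rewrite divr_gt0.
move=> i theta thetaT.
apply/lmi_aP; [exact: sym_mix|exact: posdef_sym|] => v.
have YE : Y i theta *m v = E theta *m (Jbar J K i *m v) by rewrite /Y -mulmxA.
have := eG i theta v thetaT; rewrite GE YE => le1.
have le2 : e / q.+1%:R * dot v v <= e * `|v| ^+ 2.
  rewrite -mulrA ler_wpM2l ?(ltW e0)// mulrC ler_pdivrMr// mulrC.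
  by apply: le_trans (dot_le_norm v) _; rewrite ler_wpM2r ?sqr_ge0// ler_nat.
by rewrite -lerBrDl; exact: le_trans le1.
Qed.
End Conditions.

(** * Stability of the closed loop *)

Section Flow.
Variable R : realType.

Lemma qform_le_norm q (X : 'M[R]_q) v :
  qform X v <= q%:R ^+ 2 * `|X| * `|v| ^+ 2.
Proof.
rewrite /qform; apply: le_trans (ler_norm _) _.
apply: le_trans (ler_mx_entry _ _ _) _.
apply: le_trans (ler_norm_mulmx _ _) _.
apply: (@le_trans _ _ (q%:R * (q%:R * `|v^T| * `|X|) * `|v|)).
  by rewrite ler_wpM2r// ler_wpM2l// ler_norm_mulmx.
by rewrite norm_trmx le_eqVlt; apply/orP; left; apply/eqP; ring.
Qed.

(** The product exp(-(y - a) F) f(y) has zero derivative on the open interval, so its end limits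
    agree. The right limit [l] replaces [f a] because trajectories may jump at [a]. *)
Lemma linear_flow q (F : 'M[R]_q) (f : R -> 'cV[R]_q) (a b : R) l : a < b ->
  (forall x, a < x < b -> is_derive_within `]a, b[ f x (F *m f x)) ->
  f y @[y --> a^'+] --> l -> f y @[y --> b^'-] --> f b ->
  f b = expmx ((b - a) *: F) *m l.
Proof.
move=> ab fd fa fb; pose Y y := expmx ((y - a) *: - F).
have Yd D y : is_derive_within D Y y (- F *m Y y).
  exact: is_derive_within_shift (@is_derive_within_expmx _ _ _ _ _).
have Yc y : Y r @[r --> y] --> Y y.
  apply: (cvg_comp (fun r => r - a) (fun r => expmx (r *: - F)) _
    (@expmx_continuous _ _ (- F) _)).
  by apply: cvgB => //; exact: cvg_cst.
have : Y a *m l = Y b *m f b.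
  apply: (@is_derive_within0_eq _ _ _ (fun y => Y y *m f y) _ _ _ _ ab).
  - move=> x xab; have := is_derive_within_mulmx (Yd _ x) (fd x xab).
    congr is_derive_within.
    have -> : - F *m Y x = Y x *m - F by exact: mulmx_expmxC.
    by rewrite mulmxN mulNmx mulmxA addNr.
  - by apply: cvg_mulmx => //; apply: cvg_at_right_filter; exact: Yc.
  - by apply: cvg_mulmx => //; apply: cvg_at_left_filter; exact: Yc.
rewrite {1}/Y subrr scale0r expmx0 mul1mx => ->.
by rewrite mulmxA (mulmx1C (expmxN _ _)) mul1mx.
Qed.
End Flow.

Section Stability.
Variables (R : realType) (n m N : nat).
Variables (A : 'M[R]_n) (B : 'M[R]_(n, m)) (J : 'I_N -> 'M[R]_n).
Variables (K : 'I_N -> 'M[R]_(m, n + m)) (P : 'I_N -> 'M[R]_(n + m)).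
Variables (Tmin Tmax : R) (t : nat -> R).
Hypotheses (Tmin0 : 0 < Tmin) (dwell : range_dwell_time Tmin Tmax t).

Local Notation q := (n + m)%N.
Local Notation F := (Abar A B).

Let t_incr k : t k + Tmin <= t k.+1.
Proof. by have := dwell.2 k; rewrite in_itv /= => /andP[]; lra. Qed.

Let t_le i j : (i <= j)%N -> t i <= t j.
Proof.
elim: j => [|j IH]; first by rewrite leqn0 => /eqP->.
rewrite leq_eqVlt => /predU1P[->//|/IH/le_trans]; apply.
by apply: le_trans (t_incr j); rewrite lerDl ltW.
Qed.

Let t_ge0 k : 0 <= t k.
Proof. exact: le_trans dwell.1 (t_le (leq0n k)). Qed.

Let Abar_mul (x : 'cV[R]_n) (u : 'cV[R]_m) :
  F *m col_mx x u = col_mx (A *m x + B *m u) 0.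
Proof. by rewrite mul_block_col !mul0mx addr0. Qed.

(** The instants grow at least like t 0 + j Tmin, so some instant is at or beyond [s]; the interval
    ends at the first such one. *)
Lemma dwell_time_cover k s : t k < s ->
  exists2 j, (k <= j)%N & t j < s <= t j.+1.
Proof.
move=> tks.
have ex : exists j, s <= t j.
  have tN j : t 0%N + Tmin * j%:R <= t j.
    elim: j => [|j]; first by rewrite mulr0 addr0.
    by have := t_incr j; rewrite -natr1; lra.
  have := archi_boundP (ltW (divr_gt0 (le_lt_trans (t_ge0 k) tks) Tmin0)).
  rewrite ltr_pdivrMr// => sb; exists (Num.bound (s / Tmin)).
  by apply: le_trans (tN _); have := dwell.1; lra.
case: (ex_minnP ex) => -[|j] sj jmin.
  by have := t_le (leq0n k); lra.
have tjs : t j < s by rewrite ltNge; apply/negP => /jmin; rewrite ltnn.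
exists j; last by rewrite tjs.
by rewrite leqNgt; apply/negP => /t_le; lra.
Qed.

Section Trajectory.
Variables (x : R -> 'cV[R]_n) (u : R -> 'cV[R]_m).
Variables (sigma : R -> 'I_N) (sp : nat -> 'I_N).
Hypothesis traj : closed_loop_trajectory A B J K P t x u sigma sp.

Let chi s := col_mx (x s) (u s).

Let flow a b : 0 <= a -> a < b -> (forall k, ~~ (a < t k < b)) ->
  (forall r, a < r <= b -> u r = u b) ->
  forall l, x r @[r --> a^'+] --> l -> chi b = expmx ((b - a) *: F) *m col_mx l (u b).
Proof.
move=> a0 ab tab uc l xl.
apply: (@linear_flow _ _ F (fun r => col_mx (x r) (u b))) => //.
- move=> r /andP[ar rb]; rewrite Abar_mul; apply: is_derive_within_col_mx.
    rewrite -(uc r) ?ar ?ltW//; apply: is_derive_withinW (traj_flow traj _ _).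
    + by move=> y /=; rewrite in_itv /= => /andP[/(le_lt_trans a0)/ltW].
    + exact: le_trans (ltW ar).
    + by move=> k; apply: contra (tab k) => /eqP <-; rewrite ar rb.
  exact: is_derive_within_cst.
- by apply: cvg_col_mx => //; exact: cvg_cst.
- apply: cvg_col_mx; last exact: cvg_cst.
  by apply: (traj_left_continuous traj); exact: le_lt_trans ab.
Qed.

(** The vector [Jbar J K (sp k) *m chi (t k)] is the right limit of chi at t k: its upper block is
    the jump of x, its lower block the input held afterwards. *)
Lemma closed_loop_step k s : t k < s <= t k.+1 ->
  chi s = expmx ((s - t k) *: F) *m (Jbar J K (sp k) *m chi (t k)).
Proof.
move=> /andP[tks st]; rewrite mul_block_col mul0mx addr0.
rewrite -(traj_u traj (k := k) (s := s)) ?tks//.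
apply: flow => //; last exact: (traj_jump traj).
- move=> j; have [jk|kj] := leqP j k; first by rewrite ltNge t_le.
  by rewrite negb_and -!leNgt (le_trans st) ?orbT// t_le.
- move=> r /andP[tr rs]; rewrite (traj_u traj (k := k) (s := r)) ?tr ?(le_trans rs)//.
  by rewrite (traj_u traj (k := k) (s := s)) ?tks.
Qed.

Lemma closed_loop_init s : 0 <= s <= t 0%N -> chi s = expmx (s *: F) *m chi 0.
Proof.
move=> /andP[]; rewrite le_eqVlt => /predU1P[<- _|s0 st].
  by rewrite scale0r expmx0 mul1mx.
have tgt0 k : 0 < t k by exact: lt_le_trans (lt_le_trans s0 st) (t_le (leq0n k)).
have uE r : 0 <= r <= s -> u r = u 0.
  by move=> /andP[r0 rs]; apply: (traj_u_init traj); rewrite r0 (le_trans rs).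
(* As t 0 > 0 here, time 0 is not a switching instant, and the one-sided derivative there gives
   right continuity. *)
have x0 : x r @[r --> 0^'+] --> x 0.
  have := is_derive_within_cvg
    (traj_flow traj (lexx 0) (fun k => negbT (lt_eqF (tgt0 k)))).
  apply: cvg_trans; apply: cvg_app => D [e e0 eD]; exists e => // y ye y0.
  by apply: eD => //=; [rewrite gt_eqF|exact: ltW].
rewrite -{1}[s]subr0 {2}/chi -(uE s) ?lexx ?ltW//.
rewrite subr0 -[X in expmx (X *: _)]subr0; apply: flow => //.
  move=> k; rewrite negb_and -[~~ (t k < s)]leNgt (le_trans st) ?orbT//.
  exact: t_le.
by move=> r /andP[r0 rs]; rewrite !uE ?lexx ?(ltW r0) ?(ltW s0).
Qed.

Lemma closed_loop_lyapunov Pi eps : cond_a A B J Tmin Tmax P K Pi eps -> forall k,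
  qform (P (sp k.+1)) (chi (t k.+1)) + eps * `|chi (t k)| ^+ 2
    <= qform (P (sp k)) (chi (t k)).
Proof.
move=> [P0 Pi0 eps0 lmi] k; set i := sp k.
have chiE : chi (t k.+1) = expmx ((t k.+1 - t k) *: F) *m (Jbar J K i *m chi (t k)).
  by apply: closed_loop_step; rewrite lexx andbT (lt_le_trans _ (t_incr k))// ltrDl.
have [_ /(_ (chi (t k)))] := lmi i _ (dwell.2 k).
have -> : expmx ((t k.+1 - t k) *: F^T) = (expmx ((t k.+1 - t k) *: F))^T.
  by rewrite -expmx_tr linearZ.
rewrite qformD qform_scalar_mx qformD qformN.
have -> (Y Z M : 'M[R]_q) : Y^T *m Z^T *m M *m Z *m Y = (Z *m Y)^T *m M *m (Z *m Y).
  by rewrite trmx_mul !mulmxA.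
rewrite qform_conj -mulmxA -chiE qform_sum.
set S := \sum_j _ => le1.
(* The weights sum to 1 and the rule at t k.+1 makes the left side at most each of the averaged
   values. *)
have le2 : qform (P (sp k.+1)) (chi (t k.+1)) <= S.
  rewrite -[leLHS]mul1r -(colstochastic_sum i Pi0) mulr_suml.
  apply: ler_sum => j _; rewrite qformZ ler_wpM2l//; first exact: Pi0.1.
  exact: (traj_rule traj).
have le3 : eps * `|chi (t k)| ^+ 2 <= eps * dot (chi (t k)) (chi (t k)).
  by rewrite ler_wpM2l ?(ltW eps0)// dot_ge_norm.
lra.
Qed.

End Trajectory.

(** * Geometric decay and asymptotic stability *)

Lemma expmx_bounded (X : 'M[R]_q) T : 0 <= T ->
  exists2 C, 0 < C & forall s (v : 'cV[R]_q), 0 <= s <= T ->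
    `|expmx (s *: X) *m v| <= C * `|v|.
Proof.
move=> T0; have Xc : continuous (fun s : R => `|expmx (s *: X)|).
  move=> s; apply: (cvg_comp (fun s : R => expmx (s *: X)) (fun Y : 'M[R]_q => `|Y|)).
    exact: expmx_continuous.
  exact: norm_continuous.
have [c _ cmax] := EVT_max T0 (continuous_subspaceT Xc).
exists (1 + q%:R * `|expmx (c *: X)|); first by rewrite ltr_pwDl// mulr_ge0.
move=> s v sT; apply: le_trans (ler_norm_mulmx _ _) _; rewrite ler_wpM2r//.
apply: ler_wpDl; first exact: ler01.
apply: ler_wpM2l; first exact: ler0n.
by apply: cmax; rewrite in_itv.
Qed.

(** One estimate for both halves of stability: the bound uniform in time gives Lyapunov stability,
    the one with a rate per switching instant gives convergence. [D] and [rho] do not depend on the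
    trajectory. *)
Lemma closed_loop_decay Pi eps : cond_a A B J Tmin Tmax P K Pi eps ->
  exists D rho : R, [/\ 1 <= D, 0 <= rho < 1 &
    forall chi, closed_loop A B J K P t chi -> forall s : R, 0 <= s ->
      `|chi s| ^+ 2 <= D * `|chi 0| ^+ 2 /\
      forall k, t k < s -> `|chi s| ^+ 2 <= D * rho ^+ k * `|chi 0| ^+ 2].
Proof.
move=> Pa; have [P0 _ eps0 _] := Pa.
have Tmax0 : 0 <= Tmax.
  by have := dwell.2 0%N; rewrite in_itv /= => /andP[h1 h2]; have := Tmin0; lra.
have [c1 c10 Pc1] : exists2 c1, 0 < c1 & forall i v, c1 * `|v| ^+ 2 <= qform (P i) v.
  apply: finite_pos_lower_bound => [i e e' Pe e'e v|i].
    by apply: le_trans (Pe v); rewrite ler_wpM2r// sqr_ge0.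
  have [e e0 Pe] := @uniform_posdef _ _ (fun=> P i) 0 0 (fun=> cvg_cst _)
    (fun _ v _ => (P0 i).2 v).
  by exists e => // v; apply: (Pe 0); rewrite lexx.
(* The summand [eps] ensures eps <= c2, hence c2 > 0 and rho >= 0 below. *)
pose c2 := eps + \sum_i q%:R ^+ 2 * `|P i|.
have sum0 (f : 'I_N -> R) i : (forall j, 0 <= f j) -> f i <= \sum_j f j.
  by move=> f0; rewrite (bigD1 i)//= lerDl sumr_ge0.
have Pc2 i v : qform (P i) v <= c2 * `|v| ^+ 2.
  apply: le_trans (qform_le_norm _ _) _; rewrite ler_wpM2r ?sqr_ge0//.
  rewrite /c2 ler_wpDl ?(ltW eps0)//; apply: (sum0 (fun i => q%:R ^+ 2 * `|P i|)) => j.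
  by rewrite mulr_ge0// sqr_ge0.
have epsc2 : eps <= c2 by rewrite lerDl sumr_ge0// => i _; rewrite mulr_ge0// sqr_ge0.
have c20 : 0 < c2 by exact: lt_le_trans epsc2.
pose CJ := 1 + \sum_i q%:R * `|Jbar J K i|.
have CJ0 : 0 < CJ by rewrite ltr_pwDl// sumr_ge0// => i _; rewrite mulr_ge0.
have JCJ i (v : 'cV[R]_q) : `|Jbar J K i *m v| <= CJ * `|v|.
  apply: le_trans (ler_norm_mulmx _ _) _; rewrite ler_wpM2r//.
  rewrite ler_wpDl//; apply: (sum0 (fun i => q%:R * `|Jbar J K i|)) => j.
  by rewrite mulr_ge0.
(* The horizon Tmax + t 0 covers both a dwell interval and the stretch before t 0. *)
have [CE CE0 ECE] := expmx_bounded F (addr_ge0 Tmax0 (t_ge0 0)).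
(* The decrease eps |chi|^2 is at least the fraction eps / c2 of the Lyapunov value, which is at
   most c2 |chi|^2. *)
pose rho := 1 - eps / c2.
have rho01 : 0 <= rho < 1.
  by rewrite subr_ge0 ler_pdivrMr// mul1r epsc2 ltrBlDr ltrDl divr_gt0.
(* The summands give, in order, D >= 1, the bound up to t 0 and the bound after t 0. The last one
   multiplies the costs of the final partial interval, of passing between norm and Lyapunov value,
   and of the initial stretch. *)
pose D := 1 + CE ^+ 2 + (CE * CJ) ^+ 2 * (c2 / c1) * CE ^+ 2.
have D1 : 0 <= CE ^+ 2 by exact: sqr_ge0.
have D2 : 0 <= (CE * CJ) ^+ 2 * (c2 / c1) * CE ^+ 2.
  by rewrite !mulr_ge0 ?sqr_ge0 ?invr_ge0 ?ltW.
exists D, rho; split=> //; first by rewrite /D; lra.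
move=> _ [x [u [sigma [sp [traj ->]]]]] s s0 /=.
set chi := fun r => col_mx (x r) (u r).
rewrite -[col_mx (x s) (u s)]/(chi s) -[col_mx (x 0) (u 0)]/(chi 0).
have sq_le (a b c : R) : 0 <= a -> a <= b * c -> a ^+ 2 <= b ^+ 2 * c ^+ 2.
  by move=> a0 abc; rewrite -exprMn ler_sqr// nnegrE (le_trans a0).
have init r : 0 <= r <= t 0%N -> `|chi r| ^+ 2 <= CE ^+ 2 * `|chi 0| ^+ 2.
  move=> rt; apply: sq_le => //; rewrite /chi (closed_loop_init traj rt).
  by apply: ECE; case/andP: rt => -> /le_trans; apply; rewrite lerDr.
have lyap k : c1 * `|chi (t k)| ^+ 2 <= rho ^+ k * (c2 * `|chi (t 0%N)| ^+ 2).
  apply: le_trans (Pc1 (sp k) _) _.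
  elim: k => [|k IH]; first by rewrite expr0 mul1r.
  have le1 := closed_loop_lyapunov traj Pa k.
  rewrite exprS -mulrA; apply: (@le_trans _ _ (rho * qform (P (sp k)) (chi (t k)))).
    have : eps / c2 * qform (P (sp k)) (chi (t k)) <= eps * `|chi (t k)| ^+ 2.
      rewrite -mulrA ler_wpM2l ?(ltW eps0)// mulrC ler_pdivrMr// mulrC.
      exact: Pc2.
    by move: le1; rewrite -/(chi (t k)) -/(chi (t k.+1)) /rho mulrBl mul1r; lra.
  by rewrite ler_wpM2l//; case/andP: rho01.
have decay k : t k < s -> `|chi s| ^+ 2 <=
    (CE * CJ) ^+ 2 * (c2 / c1) * CE ^+ 2 * rho ^+ k * `|chi 0| ^+ 2.
  move=> /dwell_time_cover[j kj tjs].
  have st : `|chi s| ^+ 2 <= (CE * CJ) ^+ 2 * `|chi (t j)| ^+ 2.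
    apply: sq_le => //; rewrite /chi (closed_loop_step traj tjs) -mulrA.
    apply: le_trans (ECE _ _ _) _; last by rewrite ler_wpM2l ?(ltW CE0)// JCJ.
    case/andP: tjs => tj sj; rewrite subr_ge0 ltW//=.
    have := dwell.2 j; rewrite in_itv /= => /andP[_].
    by have := t_ge0 0; lra.
  have tj : `|chi (t j)| ^+ 2 <= c2 / c1 * rho ^+ j * `|chi (t 0%N)| ^+ 2.
    rewrite -(ler_pM2l c10); apply: le_trans (lyap j) _.
    by rewrite le_eqVlt; apply/orP; left; apply/eqP; field; rewrite gt_eqF.
  apply: le_trans st _; apply: le_trans (ler_wpM2l (sqr_ge0 _) tj) _.
  have it : `|chi (t 0%N)| ^+ 2 <= CE ^+ 2 * `|chi 0| ^+ 2.
    by apply: init; rewrite lexx t_ge0.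
  have rho_kj : rho ^+ j <= rho ^+ k.
    by case/andP: rho01 => r0 r1; rewrite ler_wiXn2l// ltW.
  have rhoj0 : 0 <= rho ^+ j by rewrite exprn_ge0//; case/andP: rho01.
  apply: (@le_trans _ _
    ((CE * CJ) ^+ 2 * (c2 / c1) * (rho ^+ j * `|chi (t 0%N)| ^+ 2))).
    by rewrite !mulrA.
  rewrite -[leRHS]mulrA -[leRHS]mulrA.
  apply: ler_wpM2l; first by rewrite mulr_ge0 ?sqr_ge0// divr_ge0// ltW.
  by rewrite [leRHS]mulrCA; apply: ler_pM; rewrite ?sqr_ge0.
have D_ge k (X : R) : 0 <= X ->
    (CE * CJ) ^+ 2 * (c2 / c1) * CE ^+ 2 * rho ^+ k * X <= D * rho ^+ k * X.
  move=> X0; rewrite !ler_wpM2r//; last by rewrite /D; lra.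
  by rewrite exprn_ge0//; case/andP: rho01.
split=> [|k tk]; last exact: le_trans (decay k tk) (D_ge _ _ (sqr_ge0 _)).
have [st|ts] := leP s (t 0%N).
  apply: le_trans (init s _) _; first by rewrite s0.
  by rewrite ler_wpM2r ?sqr_ge0// /D; lra.
have := le_trans (decay 0%N ts) (D_ge _ _ (sqr_ge0 _)).
by rewrite expr0 mulr1.
Qed.

Lemma cond_a_stable Pi eps : cond_a A B J Tmin Tmax P K Pi eps ->
  asymptotically_stable (closed_loop A B J K P t).
Proof.
move=> /closed_loop_decay[D [rho [D1 /andP[rho0 rho1] bound]]].
have D0 : 0 < D by exact: lt_le_trans D1.
split=> [e e0|chi chiT].
  (* No square root is needed: D (e / D)^2 = e^2 / D is at most e^2 because D >= 1. *)
  exists (e / D); first by rewrite divr_gt0.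
  move=> chi chiT chi0 s s0; have [le _] := bound chi chiT s s0.
  have : `|chi 0| ^+ 2 < (e / D) ^+ 2.
    by rewrite ltr_sqr ?nnegrE// ltW// divr_gt0.
  rewrite -(ltr_pM2l D0) => /(le_lt_trans le) lt.
  rewrite -ltr_sqr ?nnegrE ?(ltW e0)//; apply: lt_le_trans lt _.
  have -> : D * (e / D) ^+ 2 = e ^+ 2 / D by field; rewrite gt_eqF.
  by rewrite ler_pdivrMr// ler_peMr// sqr_ge0.
apply/cvgrPdist_lt => e e0.
have : D * `|chi 0| ^+ 2 * rho ^+ k @[k --> \oo] --> (0 : R).
  rewrite -[X in _ --> X](mulr0 (D * `|chi 0| ^+ 2)); apply: cvgM; first exact: cvg_cst.
  by apply: cvg_expr; rewrite ger0_norm.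
(* A single k with D |chi 0|^2 rho^k < e^2 suffices, since the decay bound holds at all times after
   t k. *)
move=> /cvgrPdist_lt /(_ _ (exprn_gt0 2 e0))[k _ /(_ k (leqnn k)) /= lt].
near=> s; rewrite sub0r normrN -ltr_sqr ?nnegrE ?(ltW e0)//.
have ts : t k < s by near: s; apply: nbhs_pinfty_gt; exact: num_real.
have s0 : 0 <= s by exact: le_trans (t_ge0 k) (ltW ts).
have [_ /(_ k ts) le] := bound chi chiT s s0.
apply: le_lt_trans le _; move: lt; rewrite sub0r normrN mulrAC; apply: le_lt_trans.
exact: ler_norm.
Unshelve. all: by end_near. Qed.

End Stability.

Theorem theorem3 (R : realType) (n m N : nat)
    (hn : (0 < n)%N) (hm : (0 < m)%N) (hN : (0 < N)%N)
    (A : 'M[R]_n) (B : 'M[R]_(n, m)) (J : 'I_N -> 'M[R]_n)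
    (Tmin Tmax : R) (hTmin : 0 < Tmin) (hT : Tmin <= Tmax) :
  let statement_a := exists P K Pi eps,
    cond_a A B J Tmin Tmax P K Pi eps in
  let statement_b := exists S dS P K Pi eps,
    cond_b A B J Tmin Tmax S dS P K Pi eps in
  let statement_c := exists S dS P U Pi eps,
    cond_c A B J Tmin Tmax S dS P U Pi eps in
  [/\ statement_a <-> statement_b,
      statement_b <-> statement_c &
      forall S dS Pt U Pi eps,
        cond_c A B J Tmin Tmax S dS Pt U Pi eps ->
        let K := fun i => U i *m invmx (Pt i) in
        let P := fun i => invmx (Pt i) in
        (exists eps', cond_a A B J Tmin Tmax P K Pi eps') /\
        (forall t : nat -> R, range_dwell_time Tmin Tmax t ->
           asymptotically_stable (closed_loop A B J K P t))].
Proof.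
move=> statement_a statement_b statement_c.
have a_b : statement_a <-> statement_b.
  split=> [[P [K [Pi [eps Pa]]]]|[S [dS [P [K [Pi [eps Pb]]]]]]].
    have [S [dS Pb]] := cond_a_to_b Pa.
    by exists S, dS, P, K, Pi, eps.
  by exists P, K, Pi, eps; exact: (cond_b_to_a hTmin Pb).
split=> [//||S dS Pt U Pi eps Pc K P].
  (* The equivalence of (b) and (c) passes through (a). *)
  rewrite -a_b; split=> [[P [K [Pi [eps Pa]]]]|[S [dS [Pt [U [Pi [eps Pc]]]]]]].
    have [S [dS Pc]] := cond_a_to_c Pa.
    by eexists S, dS, _, _, Pi, eps; exact: Pc.
  have [eps' Pa] := cond_c_to_a hTmin Pc.
  by eexists _, _, Pi, eps'; exact: Pa.
have [eps' Pa] := cond_c_to_a hTmin Pc.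
split=> [|t dwell]; first by exists eps'.
exact: (cond_a_stable hTmin dwell Pa).
Qed.
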